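(* Let $\alpha\in[1,\infty)$, $Q\in[1,\infty)$, $k=(Q-1)/(Q+1)$, and let $f\in\mathcal H(\alpha,Q)$. Then for every $z\in\mathbb D$ the function $f$ is convex in the disk $\mathbb D(z,R(z))=\{\zeta:|\zeta-z|<R(z)\}$, where $$R(z)=\frac12\left(R_0+R_0^{-1}-\sqrt{\left(R_0-R_0^{-1}\right)^2+4|z|^2}\right)$$ and $$R_0=\alpha+k^{-1}-\sqrt{k^{-2}-1}-\sqrt{\left(\alpha+k^{-1}-\sqrt{k^{-2}-1}\right)^2-1}$$ (for $k=0$ the expression $k^{-1}-\sqrt{k^{-2}-1}=\frac{1-\sqrt{1-k^2}}{k}$ is understood as its limit $0$). In particular, the radius of convexity of the family $\mathcal H(\alpha,Q)$ is no less than $R_0$.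
   Context: $\mathbb D=\{z\in\mathbb C:|z|<1\}$; $\mathrm{Aut}(\mathbb D)$ is the set of maps $\phi(z)=e^{i\theta}\frac{z+a}{1+\overline a z}$, $|a|<1$, $\theta\in\mathbb R$. A locally univalent function $f$ is convex in the disk $\mathbb D(z_0,r)=\{z:|z-z_0|<r\}$ if $f$ maps $\mathbb D(z_0,r)$ univalently onto a convex domain. The radius of convexity of a family $\mathcal F$ of functions on $\mathbb D$ is the largest number $r_0$ such that every $f\in\mathcal F$ is convex in $\mathbb D(0,r_0)$. Linear invariant families (analytic case): a non-empty collection $\mathfrak M$ of analytic functions $h$ in $\mathbb D$ with $h'\ne0$ in $\mathbb D$, normalized by $h(z)=z+\sum_{n\ge2}a_n(h)z^n$, is a linear invariant family (LIF) if for each $h\in\mathfrak M$ and $\phi\in\mathrm{Aut}(\mathbb D)$ the function $\frac{h(\phi(z))-h(\phi(0))}{h'(\phi(0))\phi'(0)}$ belongs to $\mathfrak M$. Its order is $\sup_{h\in\mathfrak M}|a_2(h)|$. $\mathcal U_\alpha$ is the union of all LIFs of order at most $\alpha$ (non-empty iff $\alpha\ge1$). The class $\mathcal H(\alpha,Q)$: the set of all locally univalent sense-preserving harmonic mappings $f=h+\overline g$ in $\mathbb D$, with $h,g$ analytic, $f(z)=\sum_{n\ge1}(a_nz^n+a_{-n}\overline z^{\,n})$ (so $h(0)=g(0)=0$, $a_1=h'(0)$, $a_{-1}=\overline{g'(0)}$), normalized by $a_1+a_{-1}=1$, such that $h(z)/h'(0)\in\mathcal U_\alpha$ and $|g'(z)/h'(z)|\le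 k$ in $\mathbb D$, with $k=(Q-1)/(Q+1)$. Sense-preserving and locally univalent means $|h'|^2-|g'|^2>0$ in $\mathbb D$. *)

(* Defs.v *)
(* Stdlib reals with Coquelicot's complex numbers [C]. *)
From Stdlib Require Import Reals.
From Coquelicot Require Import Coquelicot.

Open Scope R_scope.

(* Functions on the unit disk are represented by total functions [C -> C];
   every notion below only looks at their values on the disk. *)

Definition in_disk (z0 : C) (r : R) (z : C) : Prop := Cmod (z - z0) < r.

Definition unit_disk (z : C) : Prop := Cmod z < 1.

Definition analytic_on_disk (h : C -> C) : Prop :=
  forall z : C, unit_disk z -> ex_derive h z.

(* h(z) = sum_(n >= 0) a_n z^n throughout the unit disk. *)
Definition taylor (h : C -> C) (a : nat -> C) : Prop :=
  forall z : C, unit_disk z -> is_pseries a z (h z).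

Definition disk_automorphism (phi : C -> C) : Prop :=
  exists (theta : R) (a : C),
    Cmod a < 1 /\
    forall z : C,
      phi z = ((cos theta, sin theta) * ((z + a) / (1 + Cconj a * z)))%C.

Definition normalized_locally_univalent (h : C -> C) : Prop :=
  analytic_on_disk h /\
  (forall z : C, unit_disk z -> C_derive h z <> 0%C) /\
  exists a : nat -> C, taylor h a /\ a 0%nat = 0%C /\ a 1%nat = 1%C.

Definition koebe_transform (phi h : C -> C) : C -> C :=
  fun z =>
    ((h (phi z) - h (phi 0)) / (C_derive h (phi 0) * C_derive phi 0))%C.

Definition linear_invariant_family (M : (C -> C) -> Prop) : Prop :=
  (exists h : C -> C, M h) /\
  (forall h : C -> C, M h -> normalized_locally_univalent h) /\
  (forall h phi : C -> C,
     M h -> disk_automorphism phi -> M (koebe_transform phi h)).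

(* The supremum of |a_2(h)| over the family, possibly [p_infty]. *)
Definition family_order (M : (C -> C) -> Prop) : Rbar :=
  Lub_Rbar (fun x : R =>
    exists (h : C -> C) (a : nat -> C),
      M h /\ taylor h a /\ x = Cmod (a 2%nat)).

Definition universal_LIF (alpha : R) (h : C -> C) : Prop :=
  exists M : (C -> C) -> Prop,
    linear_invariant_family M /\
    Rbar_le (family_order M) (Finite alpha) /\
    M h.

Definition dilatation_bound (Q : R) : R := (Q - 1) / (Q + 1).

(* The coefficients [b] of [g] are related to the coefficients of
   f(z) = sum_(n >= 1) (a_n z^n + a_(-n) (conj z)^n) by a_(-n) = conj b_n. *)
Definition class_H (alpha Q : R) (f : C -> C) : Prop :=
  exists (h g : C -> C) (a b : nat -> C),
    analytic_on_disk h /\ analytic_on_disk g /\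
    taylor h a /\ taylor g b /\
    a 0%nat = 0%C /\ b 0%nat = 0%C /\
    (a 1%nat + Cconj (b 1%nat) = 1)%C /\
    (forall z : C, unit_disk z -> f z = (h z + Cconj (g z))%C) /\
    (forall z : C, unit_disk z ->
       Cmod (C_derive h z) ^ 2 - Cmod (C_derive g z) ^ 2 > 0) /\
    universal_LIF alpha (fun z => (h z / C_derive h 0)%C) /\
    (forall z : C, unit_disk z ->
       Cmod (C_derive g z / C_derive h z) <= dilatation_bound Q).

Definition convex_set (E : C -> Prop) : Prop :=
  forall (w1 w2 : C) (t : R), E w1 -> E w2 -> 0 <= t <= 1 ->
    E (t * w1 + (1 - t)%R * w2)%C.

(* Connectedness of the domain is implied by convexity. *)
Definition convex_domain (E : C -> Prop) : Prop :=
  (exists w : C, E w) /\ open E /\ convex_set E.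

(* The inclusion in the unit disk expresses that the function, which is only
   meaningful there, is defined on the whole of D(z0, r). *)
Definition convex_in_disk (f : C -> C) (z0 : C) (r : R) : Prop :=
  (forall z : C, in_disk z0 r z -> unit_disk z) /\
  (forall z1 z2 : C, in_disk z0 r z1 -> in_disk z0 r z2 ->
     f z1 = f z2 -> z1 = z2) /\
  convex_domain (fun w : C => exists z : C, in_disk z0 r z /\ w = f z).

Definition is_radius_of_convexity (F : (C -> C) -> Prop) (r0 : R) : Prop :=
  (forall f : C -> C, F f -> convex_in_disk f 0 r0) /\
  (forall r : R,
     (forall f : C -> C, F f -> convex_in_disk f 0 r) -> r <= r0).

(* k^-1 - sqrt (k^-2 - 1), extended to k = 0 by its limit. *)
Definition dilatation_shift (k : R) : R :=
  if Req_EM_T k 0 then 0 else / k - sqrt ((/ k) ^ 2 - 1).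

Definition R_zero (alpha Q : R) : R :=
  let A := alpha + dilatation_shift (dilatation_bound Q) in
  A - sqrt (A ^ 2 - 1).

Definition R_at (alpha Q : R) (z : C) : R :=
  let R0 := R_zero alpha Q in
  1 / 2 * (R0 + / R0 - sqrt ((R0 - / R0) ^ 2 + 4 * Cmod z ^ 2)).

(* Main.v *)
(** Every [h + eps g] with [|eps| = 1] has pre-Schwarzian [P] satisfying
    [|(1 - |z|^2) P(z) / 2 - conj z| <= A], where [A = alpha + 1/k - sqrt (1/k^2 - 1)]:
    the part [alpha] is the second coefficient of the Koebe transforms of [h], and the
    rest comes from the Schwarz-Pick lemma for the dilatation [omega = g'/h'], after
    maximizing [(k^2 - t^2) / (2k (1 - t))] over [t = |omega|].  Since
    [rho^2 - 2 A rho + 1 - |c|^2 > 0] for [rho < R(c)], this makes the images under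
    [F = h + eps g] of all circles inside [D(c, rho)] convex.

    To pass to [f = h + conj g], fix [w] in [D(c, rho)] and let [S] be the vector field
    generating the hyperbolic dilations of that disc fixing [w].  The quotient
    [p = (F - F(w)) / (S F')] solves [S p' + p (S' + S F''/F') = 1] with
    [Re (S' + S F''/F') > 0], so that [Re p > 0] by looking at a minimum of [Re p].
    Choosing [eps] according to the direction of [N = S h' - conj (S g')] turns this into
    [Re ((f(z) - f(w)) conj N) > 0].  This gives injectivity, and for [|z - c| = rho] it
    says that [f(z)] lies on a supporting line of the image of the disc.  A point of a
    chord missing from the image would have a nearest point on the boundary of the image,
    where it contradicts the supporting line. *)

Require Import Defs.
From Stdlib Require Import Reals Lra Lia Classical List ClassicalEpsilon.
From Coquelicot Require Import Coquelicot.

Open Scope R_scope.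

(** * Complex differentiability *)

(** Why [eps] helps: for |e| = 1, Re (conj e (h + conj g)) = Re (conj e (h + e^2 g)), so in one
    fixed direction the harmonic map and an analytic one have the same increments. The right e
    depends on z and w, hence the bound uniform in [eps]. Re p > 0 is starlikeness of the image of F
    about F(w), here for every w. The proof uses p rather than its reciprocal S F' / (F - F(w))
    because F - F(w) might have further zeros: injectivity is a conclusion. The quadratic in rho has
    R(c) as its smaller root, since R_0 + 1/R_0 = 2 A. No integral formula enters. Facts about
    holomorphic functions come from extrema of continuous functions on closed discs, with first- or
    second-order conditions there, and higher derivatives come from differentiating Taylor series
    term by term. The maximum principle behind Schwarz-Pick therefore has to cope with a difference
    quotient that is merely known to be continuous at its base point. *)

Definition cderiv (f : C -> C) (z l : C) : Prop :=
  forall eps : R, 0 < eps -> exists d : R, 0 < d /\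
    forall y : C, Cmod (y - z) < d ->
      Cmod (f y - f z - l * (y - z)) <= eps * Cmod (y - z).

Definition ccont (f : C -> C) (z : C) : Prop :=
  forall eps : R, 0 < eps -> exists d : R, 0 < d /\
    forall y : C, Cmod (y - z) < d -> Cmod (f y - f z) < eps.

Lemma Cminus_self (z : C) : (z - z)%C = 0.
Proof. unfold Cminus; apply Cplus_opp_r. Qed.

Lemma Cmod_minus_sym (x y : C) : Cmod (x - y) = Cmod (y - x).
Proof. rewrite <- Cmod_opp. f_equal. ring. Qed.

Lemma Cmod_minus_ge (x y : C) : Cmod x - Cmod y <= Cmod (x - y).
Proof.
generalize (Cmod_triangle (x - y) y).
replace (x - y + y)%C with x by ring. lra.
Qed.

Lemma Cmod_minus_triangle (x y z : C) : Cmod (x - z) <= Cmod (x - y) + Cmod (y - z).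
Proof.
replace (x - z)%C with ((x - y) + (y - z))%C by ring. apply Cmod_triangle.
Qed.

(** C carries two normed-module structures over itself; an estimate in [Cmod] alone is the same for
    both and chains directly with the other estimates below. *)
Lemma is_derive_cderiv (f : C -> C) (z l : C) :
  is_derive (V := C_NormedModule) f z l <-> cderiv f z l.
Proof.
split.
- intros [_ H] eps He.
  specialize (H z (fun P HP => HP) (mkposreal eps He)).
  destruct H as [d Hd]. exists d; split; [apply cond_pos|].
  intros y Hy.
  specialize (Hd y Hy). simpl in Hd.
  change (Cmod ((f y - f z) - (y - z) * l) <= eps * Cmod (y - z)) in Hd.
  now rewrite (Cmult_comm l).
- intros H. split. apply is_linear_scal_l.
  intros x Hx eps.
  assert (x = z) as -> .
  { apply eq_sym, (is_filter_lim_locally_unique (V := AbsRing_NormedModule C_AbsRing)); exact Hx. }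
  destruct (H eps (cond_pos eps)) as [d [Hd H']].
  exists (mkposreal d Hd). intros y Hy.
  change (Cmod ((f y - f z) - (y - z) * l) <= eps * Cmod (y - z)).
  rewrite (Cmult_comm (y - z)). apply H'. exact Hy.
Qed.

Lemma cderiv_C_derive (f : C -> C) (z l : C) : cderiv f z l -> C_derive f z = l.
Proof. intros H. apply is_C_derive_unique, is_derive_cderiv, H. Qed.

Lemma cderiv_unique (f : C -> C) (z l1 l2 : C) : cderiv f z l1 -> cderiv f z l2 -> l1 = l2.
Proof.
intros H1 H2. now rewrite <- (cderiv_C_derive _ _ _ H1), <- (cderiv_C_derive _ _ _ H2).
Qed.

Lemma cderiv_local (f g : C -> C) (z l : C) (d : R) :
  0 < d -> (forall y, Cmod (y - z) < d -> f y = g y) -> cderiv f z l -> cderiv g z l.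
Proof.
intros Hd E H eps He. destruct (H eps He) as [d' [Hd' H']].
exists (Rmin d d'); split; [now apply Rmin_pos|].
intros y Hy. rewrite <- !E.
- apply H'. eapply Rlt_le_trans; [exact Hy|apply Rmin_r].
- rewrite Cminus_self, Cmod_0. exact Hd.
- eapply Rlt_le_trans; [exact Hy|apply Rmin_l].
Qed.

Lemma cderiv_const (c z : C) : cderiv (fun _ => c) z 0.
Proof. apply is_derive_cderiv. apply (is_derive_const (V := C_NormedModule)). Qed.

Lemma cderiv_id (z : C) : cderiv (fun y => y) z 1.
Proof.
intros eps He. exists 1; split; [lra|]. intros y _.
replace (y - z - 1 * (y - z))%C with (RtoC 0) by ring.
rewrite Cmod_0. apply Rmult_le_pos; [lra|apply Cmod_ge_0].
Qed.

Lemma cderiv_plus (f g : C -> C) (z l m : C) :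
  cderiv f z l -> cderiv g z m -> cderiv (fun y => f y + g y)%C z (l + m).
Proof.
intros Hf Hg. apply is_derive_cderiv.
apply (is_derive_plus (V := C_NormedModule)); now apply is_derive_cderiv.
Qed.

Lemma cderiv_ccont (f : C -> C) (z l : C) : cderiv f z l -> ccont f z.
Proof.
intros H eps He.
destruct (H 1 Rlt_0_1) as [d [Hd H']].
assert (P : 0 < 1 + Cmod l) by (generalize (Cmod_ge_0 l); lra).
exists (Rmin d (eps / (1 + Cmod l))); split.
{ apply Rmin_pos; [exact Hd|]. now apply Rdiv_lt_0_compat. }
intros y Hy.
assert (Hy1 : Cmod (y - z) < d) by (eapply Rlt_le_trans; [exact Hy|apply Rmin_l]).
assert (Hy2 : Cmod (y - z) < eps / (1 + Cmod l)) by (eapply Rlt_le_trans; [exact Hy|apply Rmin_r]).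
specialize (H' y Hy1).
replace (f y - f z)%C with ((f y - f z - l * (y - z)) + l * (y - z))%C by ring.
eapply Rle_lt_trans; [apply Cmod_triangle|].
rewrite Cmod_mult.
apply Rlt_div_r in Hy2; [|exact P]. nra.
Qed.

Lemma ccont_bounded (f : C -> C) (z : C) :
  ccont f z -> exists d, 0 < d /\ forall y, Cmod (y - z) < d -> Cmod (f y) <= Cmod (f z) + 1.
Proof.
intros H. destruct (H 1 Rlt_0_1) as [d [Hd H']]. exists d; split; [exact Hd|].
intros y Hy. specialize (H' y Hy). generalize (Cmod_minus_ge (f y) (f z)). lra.
Qed.

Lemma ccont_mult (f g : C -> C) (z : C) :
  ccont f z -> ccont g z -> ccont (fun y => f y * g y)%C z.
Proof.
intros Hf Hg eps He.
destruct (ccont_bounded f z Hf) as [d0 [Hd0 Hb]].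
assert (Pf : 0 < Cmod (f z) + 1) by (generalize (Cmod_ge_0 (f z)); lra).
assert (Pg : 0 < Cmod (g z) + 1) by (generalize (Cmod_ge_0 (g z)); lra).
destruct (Hf (eps / 2 / (Cmod (g z) + 1))) as [d1 [Hd1 H1]].
{ apply Rdiv_lt_0_compat; lra. }
destruct (Hg (eps / 2 / (Cmod (f z) + 1))) as [d2 [Hd2 H2]].
{ apply Rdiv_lt_0_compat; lra. }
exists (Rmin d0 (Rmin d1 d2)); split.
{ repeat apply Rmin_pos; assumption. }
intros y Hy.
assert (Cmod (y - z) < d0 /\ Cmod (y - z) < d1 /\ Cmod (y - z) < d2) as [A0 [A1 A2]].
{ repeat split; eapply Rlt_le_trans; [exact Hy|apply Rmin_l|exact Hy| |exact Hy|];
  (eapply Rle_trans; [apply Rmin_r|]); [apply Rmin_l|apply Rmin_r]. }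
specialize (Hb y A0); specialize (H1 y A1); specialize (H2 y A2).
apply Rlt_div_r in H1; [|exact Pg]. apply Rlt_div_r in H2; [|exact Pf].
replace (f y * g y - f z * g z)%C with (f y * (g y - g z) + (f y - f z) * g z)%C by ring.
eapply Rle_lt_trans; [apply Cmod_triangle|].
rewrite !Cmod_mult.
generalize (Cmod_ge_0 (g y - g z)) (Cmod_ge_0 (f y - f z)) (Cmod_ge_0 (g z)) (Cmod_ge_0 (f z)). nra.
Qed.

Lemma cderiv_mult (f g : C -> C) (z l m : C) :
  cderiv f z l -> cderiv g z m -> cderiv (fun y => f y * g y)%C z (l * g z + f z * m).
Proof.
intros Hf Hg eps He.
assert (Hc : ccont g z) by (eapply cderiv_ccont; exact Hg).
assert (Pf : 0 < Cmod (f z) + 1) by (generalize (Cmod_ge_0 (f z)); lra).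
assert (Pl : 0 < Cmod l + 1) by (generalize (Cmod_ge_0 l); lra).
assert (Pg : 0 < Cmod (g z) + 1) by (generalize (Cmod_ge_0 (g z)); lra).
destruct (ccont_bounded g z Hc) as [d0 [Hd0 Hb]].
destruct (Hf (eps / 3 / (Cmod (g z) + 1))) as [d1 [Hd1 H1]].
{ apply Rdiv_lt_0_compat; lra. }
destruct (Hg (eps / 3 / (Cmod (f z) + 1))) as [d2 [Hd2 H2]].
{ apply Rdiv_lt_0_compat; lra. }
destruct (Hc (eps / 3 / (Cmod l + 1))) as [d3 [Hd3 H3]].
{ apply Rdiv_lt_0_compat; lra. }
exists (Rmin (Rmin d0 d1) (Rmin d2 d3)); split.
{ repeat apply Rmin_pos; assumption. }
intros y Hy.
assert (Cmod (y - z) < d0 /\ Cmod (y - z) < d1 /\ Cmod (y - z) < d2 /\ Cmod (y - z) < d3)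
  as [A0 [A1 [A2 A3]]].
{ generalize (Rmin_l (Rmin d0 d1) (Rmin d2 d3)) (Rmin_r (Rmin d0 d1) (Rmin d2 d3))
   (Rmin_l d0 d1) (Rmin_r d0 d1) (Rmin_l d2 d3) (Rmin_r d2 d3). intros. repeat split; lra. }
specialize (Hb y A0); specialize (H1 y A1); specialize (H2 y A2); specialize (H3 y A3).
apply Rlt_div_r in H3; [|exact Pl].
set (D := Cmod (y - z)) in *.
assert (0 <= D) by apply Cmod_ge_0.
assert (K1 : Cmod (f y - f z - l * (y - z)) * (Cmod (g z) + 1) <= eps / 3 * D).
{ apply (Rmult_le_compat_r (Cmod (g z) + 1)) in H1; [|lra].
  eapply Rle_trans; [exact H1|]. apply Req_le. field. lra. }
assert (K2 : Cmod (g y - g z - m * (y - z)) * (Cmod (f z) + 1) <= eps / 3 * D).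
{ apply (Rmult_le_compat_r (Cmod (f z) + 1)) in H2; [|lra].
  eapply Rle_trans; [exact H2|]. apply Req_le. field. lra. }
replace (f y * g y - f z * g z - (l * g z + f z * m) * (y - z))%C
  with ((f y - f z - l * (y - z)) * g y + (f z * (g y - g z - m * (y - z))
        + l * (y - z) * (g y - g z)))%C by ring.
eapply Rle_trans; [apply Cmod_triangle|].
eapply Rle_trans; [apply Rplus_le_compat_l, Cmod_triangle|].
rewrite !Cmod_mult. fold D.
generalize (Cmod_ge_0 (f y - f z - l * (y - z))) (Cmod_ge_0 (g y - g z - m * (y - z)))
  (Cmod_ge_0 (g y - g z)) (Cmod_ge_0 (f z)) (Cmod_ge_0 l).
set (u := Cmod (f y - f z - l * (y - z))) in *.
set (v := Cmod (g y - g z - m * (y - z))) in *.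
set (t := Cmod (g y - g z)) in *.
intros.
assert (u * Cmod (g y) <= eps / 3 * D) by nra.
assert (Cmod (f z) * v <= eps / 3 * D) by nra.
assert (Cmod l * D * t <= eps / 3 * D).
{ assert (Cmod l * t <= eps / 3) by nra. nra. }
lra.
Qed.

Lemma cderiv_comp (f g : C -> C) (z l m : C) :
  cderiv f (g z) l -> cderiv g z m -> cderiv (fun y => f (g y)) z (l * m).
Proof.
intros Hf Hg. rewrite Cmult_comm. apply is_derive_cderiv.
apply (is_derive_comp (V := C_NormedModule) f g z l m).
- now apply is_derive_cderiv.
(* [is_derive_comp] takes the inner derivative with values in C as a module over itself, not in
   [C_NormedModule]; the estimate [H] serves both. *)
- apply is_derive_cderiv in Hg. destruct Hg as [_ H].
  split; [apply is_linear_scal_l|exact H].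
Qed.

Lemma cderiv_inv0 (z : C) : z <> 0 -> cderiv (fun y => / y)%C z (- / (z * z))%C.
Proof.
intros Hz eps He.
assert (P : 0 < Cmod z) by now apply Cmod_gt_0.
set (r := Cmod z) in *.
(* The first radius keeps |y| > r / 2, the second absorbs the remainder (y - z)^2 / (y z^2). *)
exists (Rmin (r / 2) (eps * (r * r * r) / 2)); split.
{ apply Rmin_pos; [lra|]. apply Rdiv_lt_0_compat; [|lra].
  repeat apply Rmult_lt_0_compat; assumption. }
intros y Hy.
assert (Hy1 : Cmod (y - z) < r / 2) by (eapply Rlt_le_trans; [exact Hy|apply Rmin_l]).
assert (Hy2 : Cmod (y - z) < eps * (r * r * r) / 2) by (eapply Rlt_le_trans; [exact Hy|apply Rmin_r]).
assert (Hm : r / 2 < Cmod y).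
{ generalize (Cmod_minus_ge z y). rewrite Cmod_minus_sym. unfold r in *. lra. }
assert (Hy0 : y <> 0) by (apply Cmod_gt_0; lra).
replace (/ y - / z - - / (z * z) * (y - z))%C with ((y - z) * (y - z) / (y * (z * z)))%C
  by (field; split; assumption).
rewrite Cmod_div, !Cmod_mult.
2: repeat apply Cmult_neq_0; assumption.
fold r. assert (0 <= Cmod (y - z)) by apply Cmod_ge_0.
apply Rle_div_l.
{ repeat apply Rmult_lt_0_compat; lra. }
set (D := Cmod (y - z)) in *.
assert (0 < r * r) by nra.
assert (D <= eps * (Cmod y * (r * r))).
{ assert (r / 2 * (r * r) <= Cmod y * (r * r)) by (apply Rmult_le_compat_r; lra).
  assert (eps * (r / 2 * (r * r)) <= eps * (Cmod y * (r * r))) by (apply Rmult_le_compat_l; lra).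
  lra. }
replace (eps * D * (Cmod y * (r * r))) with (D * (eps * (Cmod y * (r * r)))) by ring.
apply Rmult_le_compat_l; assumption.
Qed.

Lemma cderiv_inv (f : C -> C) (z l : C) :
  f z <> 0 -> cderiv f z l -> cderiv (fun y => / f y)%C z (- l / (f z * f z)).
Proof.
intros Hz Hf.
replace (- l / (f z * f z))%C with (- / (f z * f z) * l)%C by (field; exact Hz).
apply (cderiv_comp (fun y => / y)%C f); [now apply cderiv_inv0|exact Hf].
Qed.

Lemma cderiv_ext (f g : C -> C) (z l : C) :
  (forall y, f y = g y) -> cderiv f z l -> cderiv g z l.
Proof. intros E. apply (cderiv_local f g z l 1); [lra|auto]. Qed.

Lemma cderiv_eq (f : C -> C) (z l l' : C) : l = l' -> cderiv f z l -> cderiv f z l'.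
Proof. now intros ->. Qed.

Lemma cderiv_scal (c : C) (f : C -> C) (z l : C) :
  cderiv f z l -> cderiv (fun y => c * f y)%C z (c * l).
Proof.
intros H. eapply cderiv_eq; [|apply (cderiv_mult (fun _ => c) f z 0 l); [apply cderiv_const|exact H]].
ring.
Qed.

Lemma cderiv_minus (f g : C -> C) (z l m : C) :
  cderiv f z l -> cderiv g z m -> cderiv (fun y => f y - g y)%C z (l - m).
Proof.
intros Hf Hg. apply (cderiv_ext (fun y => f y + (-(1)) * g y)%C); [intros; ring|].
eapply cderiv_eq; [|apply cderiv_plus; [exact Hf|apply cderiv_scal; exact Hg]]. ring.
Qed.

Lemma cderiv_div (f g : C -> C) (z l m : C) :
  g z <> 0 -> cderiv f z l -> cderiv g z m ->
  cderiv (fun y => f y / g y)%C z ((l * g z - f z * m) / (g z * g z)).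
Proof.
intros Hz Hf Hg.
eapply cderiv_eq; [|apply (cderiv_mult f (fun y => / g y)%C); [exact Hf|apply cderiv_inv; eassumption]].
field. exact Hz.
Qed.

Lemma cderiv_affine (a b z : C) : cderiv (fun y => a + b * y)%C z b.
Proof.
eapply cderiv_eq; [|apply cderiv_plus; [apply cderiv_const|apply cderiv_scal, cderiv_id]]. ring.
Qed.

(** * Extrema on closed discs *)

Lemma im_le_Cmod (z : C) : Rabs (Im z) <= Cmod z.
Proof. eapply Rle_trans; [apply Rmax_r|apply (Rmax_Cmod z)]. Qed.

Lemma Cmod_le_abs (z : C) : Cmod z <= Rabs (Re z) + Rabs (Im z).
Proof.
assert (H := Cmod2_alt z).
generalize (Rabs_pos (Re z)) (Rabs_pos (Im z)) (Cmod_ge_0 z).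
rewrite <- (pow2_abs (Re z)), <- (pow2_abs (Im z)) in H. nra.
Qed.

(** Without a minimum, every point of the disc has a neighbourhood on which [U] exceeds its value at
    some fixed point of the disc; points of the surrounding square outside the disc get a
    neighbourhood missing it. Among the finitely many values of a finite subcover, the least would
    exceed another one. *)
Lemma disc_min (U : C -> R) (z0 : C) (rho : R) :
  0 <= rho ->
  (forall z, Cmod (z - z0) <= rho -> forall eps, 0 < eps -> exists d, 0 < d /\
     forall y, Cmod (y - z0) <= rho -> Cmod (y - z) < d -> Rabs (U y - U z) < eps) ->
  exists z, Cmod (z - z0) <= rho /\ forall y, Cmod (y - z0) <= rho -> U z <= U y.
Proof.
intros Hrho HU.
apply NNPP; intros Hno.
set (pt := fun t : Compactness.Tn 2 R => ((fst t, fst (snd t)) : C)).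
assert (Hloc : forall t : Compactness.Tn 2 R, exists p : posreal * C,
  Cmod (snd p - z0) <= rho /\
  forall y, Cmod (y - z0) <= rho -> Rabs (Re y - Re (pt t)) < fst p ->
    Rabs (Im y - Im (pt t)) < fst p -> U (snd p) < U y).
{ intros t. destruct (Rle_lt_dec (Cmod (pt t - z0)) rho) as [Hin|Hout].
  - assert (exists q, Cmod (q - z0) <= rho /\ U q < U (pt t)) as [q [Hq Hlt]].
    { apply NNPP; intros Hn. apply Hno. exists (pt t); split; [exact Hin|].
      intros y Hy. apply Rnot_lt_le; intros Hl. apply Hn. now exists y. }
    destruct (HU _ Hin (U (pt t) - U q)) as [d [Hd H]]; [lra|].
    assert (Hd2 : 0 < d / 2) by lra.
    exists (mkposreal _ Hd2, q); cbn [fst snd pos]; split; [exact Hq|].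
    intros y Hy H1 H2.
    assert (Cmod (y - pt t) < d).
    { eapply Rle_lt_trans; [apply Cmod_le_abs|].
      change (Rabs (Re y - Re (pt t)) + Rabs (Im y - Im (pt t)) < d). lra. }
    specialize (H y Hy H0). apply Rabs_def2 in H. destruct H. lra.
  - assert (Hd2 : 0 < (Cmod (pt t - z0) - rho) / 2) by lra.
    exists (mkposreal _ Hd2, z0); cbn [fst snd pos]; split.
    { rewrite Cminus_self, Cmod_0. exact Hrho. }
    intros y Hy H1 H2. exfalso.
    assert (Cmod (y - pt t) < Cmod (pt t - z0) - rho).
    { eapply Rle_lt_trans; [apply Cmod_le_abs|].
      change (Rabs (Re y - Re (pt t)) + Rabs (Im y - Im (pt t)) < Cmod (pt t - z0) - rho). lra. }
    generalize (Cmod_minus_triangle (pt t) y z0). rewrite (Cmod_minus_sym (pt t) y). lra. }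
set (F := fun t => proj1_sig (constructive_indefinite_description _ (Hloc t))).
assert (HF : forall t, Cmod (snd (F t) - z0) <= rho /\
  forall y, Cmod (y - z0) <= rho -> Rabs (Re y - Re (pt t)) < fst (F t) ->
    Rabs (Im y - Im (pt t)) < fst (F t) -> U (snd (F t)) < U y).
{ intros t. unfold F. destruct (constructive_indefinite_description _ (Hloc t)). assumption. }
clearbody F.
(* [compactness_list] yields the finite cover under a double negation, which suffices for the goal
   [False]. *)
apply (compactness_list 2 (Re z0 - rho, (Im z0 - rho, tt)) (Re z0 + rho, (Im z0 + rho, tt))
  (fun t => fst (F t))).
intros [l Hl].
assert (Hcov : forall y, Cmod (y - z0) <= rho -> exists t, In t l /\ U (snd (F t)) < U y).
{ intros y Hy.
  assert (A1 := re_le_Cmod (y - z0)). assert (A2 := im_le_Cmod (y - z0)).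
  change (Rabs (Re y - Re z0) <= Cmod (y - z0)) in A1.
  change (Rabs (Im y - Im z0) <= Cmod (y - z0)) in A2.
  assert (B1 : Rabs (Re y - Re z0) <= rho) by lra.
  assert (B2 : Rabs (Im y - Im z0) <= rho) by lra.
  apply Rabs_le_between in B1. apply Rabs_le_between in B2.
  destruct (Hl (Re y, (Im y, tt))) as [t [Ht [_ Hc]]].
  { simpl. repeat split; lra. }
  exists t; split; [exact Ht|].
  destruct t as [t1 [t2 []]]. destruct Hc as [C1 [C2 _]].
  apply HF; assumption. }
assert (Hmin : forall m : list (Compactness.Tn 2 R), m <> nil ->
  exists t, In t m /\ forall s, In s m -> U (snd (F t)) <= U (snd (F s))).
{ induction m as [|t m IH]; [easy|]. intros _.
  destruct m as [|t' m].
  - exists t; split; [now left|]. intros s [<-|[]]. lra.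
  - destruct IH as [t1 [Ht1 H1]]; [easy|].
    destruct (Rle_lt_dec (U (snd (F t))) (U (snd (F t1)))) as [L|L].
    + exists t; split; [now left|]. intros s [<-|Hs]; [lra|]. specialize (H1 s Hs). lra.
    + exists t1; split; [now right|]. intros s [<-|Hs]; [lra|]. now apply H1. }
destruct (Hmin l) as [t [Ht Hmt]].
{ intros ->. destruct (Hcov z0) as [t [[] _]]. rewrite Cminus_self, Cmod_0. exact Hrho. }
destruct (Hcov (snd (F t))) as [s [Hs Hlt]]; [apply HF|].
specialize (Hmt s Hs). lra.
Qed.

(* [B] encodes the real differential [s |-> Re (B s)] of [U] at [z]. *)
Definition rdiff (U : C -> R) (z B : C) : Prop :=
  forall eps : R, 0 < eps -> exists d : R, 0 < d /\
    forall y : C, Cmod (y - z) < d ->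
      Rabs (U y - U z - Re (B * (y - z))) <= eps * Cmod (y - z).

Lemma cderiv_rdiff_Re (f : C -> C) (z l : C) : cderiv f z l -> rdiff (fun y => Re (f y)) z l.
Proof.
intros H eps He. destruct (H eps He) as [d [Hd H']]. exists d; split; [exact Hd|].
intros y Hy. specialize (H' y Hy).
eapply Rle_trans; [|exact H'].
replace (Re (f y) - Re (f z) - Re (l * (y - z))) with (Re (f y - f z - l * (y - z))).
apply re_le_Cmod. unfold Re; simpl. ring.
Qed.

Lemma rdiff_dir_nonneg (U : C -> R) (z B s : C) (t0 : R) :
  rdiff U z B -> 0 < t0 ->
  (forall t : R, 0 < t < t0 -> U z <= U (z + t * s)%C) ->
  0 <= Re (B * s).
Proof.
intros H Ht0 Hm. apply Rnot_lt_le; intros Hneg.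
set (m := - Re (B * s)).
assert (Ps : 0 < Cmod s + 1) by (generalize (Cmod_ge_0 s); lra).
destruct (H (m / 2 / (Cmod s + 1))) as [d [Hd H']].
{ apply Rdiv_lt_0_compat; [unfold m; lra|exact Ps]. }
set (t := Rmin (t0 / 2) (d / 2 / (Cmod s + 1))).
assert (Ht : 0 < t).
{ apply Rmin_pos; [lra|]. apply Rdiv_lt_0_compat; [lra|exact Ps]. }
assert (Htt : t < t0) by (generalize (Rmin_l (t0 / 2) (d / 2 / (Cmod s + 1))); fold t; lra).
assert (Hts : t * (Cmod s + 1) <= d / 2).
{ apply Rle_div_r; [lra|]. apply Rmin_r. }
assert (E : (z + t * s - z)%C = (t * s)%C) by ring.
specialize (H' (z + t * s)%C). rewrite E, Cmod_mult, Cmod_R, Rabs_pos_eq in H'; [|lra].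
assert (Hb : t * Cmod s < d) by lra.
specialize (H' Hb). specialize (Hm t (conj Ht Htt)).
replace (Re (B * (t * s))) with (t * Re (B * s)) in H' by (unfold Re; simpl; ring).
apply Rabs_le_between in H'.
assert (m / 2 / (Cmod s + 1) * (t * Cmod s) <= m / 2 * t).
{ replace (m / 2 / (Cmod s + 1) * (t * Cmod s)) with (m / 2 * t * (Cmod s / (Cmod s + 1))) by (field; lra).
  rewrite <- (Rmult_1_r (m / 2 * t)) at 2. apply Rmult_le_compat_l.
  - unfold m; nra.
  - apply Rle_div_l; lra. }
unfold m in *. nra.
Qed.

(** Tested in the direction of steepest descent [- Cconj B], where the differential equals -
    |B|^2. *)
Lemma min_interior (U : C -> R) (z0 z B : C) (rho : R) :
  rdiff U z B -> Cmod (z - z0) < rho ->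
  (forall y, Cmod (y - z0) <= rho -> U z <= U y) -> B = 0.
Proof.
intros HU Hz Hm.
assert (H : 0 <= Re (B * (- Cconj B))).
{ apply (rdiff_dir_nonneg U z B _ ((rho - Cmod (z - z0)) / (Cmod B + 1)) HU).
  - apply Rdiv_lt_0_compat; [lra|]. generalize (Cmod_ge_0 B); lra.
  - intros t Ht. apply Hm.
    replace (z + t * - Cconj B - z0)%C with ((z - z0) + t * - Cconj B)%C by ring.
    eapply Rle_trans; [apply Cmod_triangle|].
    rewrite Cmod_mult, Cmod_R, Cmod_opp, Cmod_conj, Rabs_pos_eq; [|lra].
    destruct Ht as [Ht1 Ht2]. apply Rlt_div_r in Ht2; [|generalize (Cmod_ge_0 B); lra]. lra. }
replace (Re (B * - Cconj B)) with (- (Re B ^ 2 + Im B ^ 2)) in H by (unfold Re, Im; simpl; ring).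
rewrite <- Cmod2_alt in H.
apply Cmod_eq_0. generalize (Cmod_ge_0 B). nra.
Qed.

(** The directions - (z - z0) (1 + i tau), tau real, all point into the disc. They give - x + tau y
    >= 0 for every tau, so the tangential part y vanishes and the outward part x is at most 0. *)
Lemma min_boundary (U : C -> R) (z0 z B : C) (rho : R) :
  0 < rho -> rdiff U z B -> Cmod (z - z0) = rho ->
  (forall y, Cmod (y - z0) <= rho -> U z <= U y) ->
  Im (B * (z - z0)) = 0 /\ Re (B * (z - z0)) <= 0.
Proof.
intros Hrho HU Hz Hm.
assert (H : forall tau : R, 0 <= Re (B * (- (z - z0) * (1 + tau * Ci)))).
{ intros tau.
  apply (rdiff_dir_nonneg U z B _ (/ (1 + tau ^ 2)) HU).
  - apply Rinv_0_lt_compat. nra.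
  - intros t [Ht1 Ht2]. apply Hm.
    replace (z + t * (- (z - z0) * (1 + tau * Ci)) - z0)%C with ((z - z0) * (1 - t - t * tau * Ci))%C by ring.
    rewrite Cmod_mult, Hz. rewrite <- (Rmult_1_r rho) at 2. apply Rmult_le_compat_l; [lra|].
    assert (E : Cmod (1 - t - t * tau * Ci) ^ 2 = (1 - t) ^ 2 + (t * tau) ^ 2).
    { rewrite Cmod2_alt. unfold Re, Im; simpl. ring. }
    assert (t * (1 + tau ^ 2) < 1).
    { replace 1 with (/ (1 + tau ^ 2) * (1 + tau ^ 2)) at 2 by (field; nra).
      apply Rmult_lt_compat_r; nra. }
    generalize (Cmod_ge_0 (1 - t - t * tau * Ci)). nra. }
set (x := Re (B * (z - z0))). set (y := Im (B * (z - z0))).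
assert (H' : forall tau : R, 0 <= - x + tau * y).
{ intros tau. specialize (H tau).
  replace (Re (B * (- (z - z0) * (1 + tau * Ci)))) with (- x + tau * y) in H; [exact H|].
  unfold x, y, Re, Im; simpl. ring. }
assert (Hx := H' 0).
assert (Hy : y = 0).
{ destruct (Req_dec y 0) as [|N]; [assumption|exfalso].
  (* This slope makes - x + tau y equal to - 1. *)
  specialize (H' ((x - 1) / y)). unfold Rdiv in H'.
  replace ((x - 1) * / y * y) with (x - 1) in H' by (field; exact N). lra. }
split; [exact Hy|lra].
Qed.

(** * Power series *)

Notation is_cseries := (@is_series C_AbsRing C_NormedModule).

Lemma pow_n_Cpow (z : C) (n : nat) : pow_n (z : C_AbsRing) n = Cpow z n.
Proof. induction n as [|n IH]; [reflexivity|]. simpl. now rewrite IH. Qed.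

Lemma is_pseries_Cpow (a : nat -> C) (z l : C) :
  is_pseries (V := C_NormedModule) a z l <-> is_cseries (fun n => Cpow z n * a n)%C l.
Proof.
split; apply is_series_ext; intros n.
- apply (f_equal (fun u => Cmult u (a n))), pow_n_Cpow.
- apply (f_equal (fun u => Cmult u (a n))), eq_sym, pow_n_Cpow.
Qed.

Lemma is_cseries_decr_1 (u : nat -> C) (l : C) :
  is_cseries (fun n => u (S n)) (l - u 0%nat)%C -> is_cseries u l.
Proof. intros H. apply (is_series_decr_1 (V := C_NormedModule)). exact H. Qed.

Lemma is_cseries_0 : is_cseries (fun _ => RtoC 0) (RtoC 0).
Proof.
apply (filterlim_ext (fun _ => RtoC 0)); [|apply filterlim_const].
intros n. induction n as [|n IH]; [now rewrite sum_O|]. rewrite sum_Sn, <- IH.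
symmetry. apply Cplus_0_l.
Qed.

Lemma is_cseries_norm_le (u : nat -> C) (b : nat -> R) (l : C) (B : R) :
  is_cseries u l -> (forall n, Cmod (u n) <= b n) -> is_series b B -> Cmod l <= B.
Proof.
intros Hu Hb HB.
assert (L1 : is_lim_seq (fun n => Cmod (sum_n (G := C_AbelianMonoid) u n)) (Cmod l)).
{ eapply filterlim_comp; [exact Hu|]. apply (filterlim_norm (V := C_NormedModule)). }
apply (is_lim_seq_le (fun n => Cmod (sum_n (G := C_AbelianMonoid) u n)) (sum_n b) (Cmod l) B).
- intros n. induction n as [|n IH].
  + rewrite !sum_O. apply Hb.
  + rewrite !sum_Sn. eapply Rle_trans; [apply Cmod_triangle|].
    apply Rplus_le_compat; [exact IH|apply Hb].
- exact L1.
- exact HB.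
Qed.

Lemma is_cseries_unique (u : nat -> C) (l m : C) : is_cseries u l -> is_cseries u m -> l = m.
Proof.
intros Hl Hm.
assert (H := is_series_minus (V := C_NormedModule) u u l m Hl Hm).
assert (Z : is_series (fun _ : nat => 0) 0).
{ apply (filterlim_ext (fun _ => 0)); [|apply filterlim_const].
  intros n. rewrite sum_n_const. ring. }
apply (is_cseries_norm_le _ (fun _ => 0) _ 0) in H.
- change (Cmod (l - m) <= 0) in H.
  replace l with (l - m + m)%C by ring. rewrite (Cmod_eq_0 (l - m)); [ring|].
  generalize (Cmod_ge_0 (l - m)). lra.
- intros n. change (Cmod (u n - u n) <= 0). rewrite Cminus_self, Cmod_0. lra.
- exact Z.
Qed.

(** Radius of convergence at least 1, stated through bounded terms: in this form it passes easily to
    n a_n and to shifts, hence to derivatives. *)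
Definition subexp (a : nat -> C) : Prop :=
  forall r : R, 0 < r < 1 -> exists M : R, forall n, Cmod (a n) * r ^ n <= M.

(** Bernoulli's inequality for (1/q)^n gives the bound 1 / (1/q - 1). *)
Lemma nat_mult_pow_bounded (q : R) : 0 < q < 1 -> exists M, forall n, INR n * q ^ n <= M.
Proof.
intros [Hq0 Hq1].
assert (P : 0 < / q - 1).
{ assert (1 < / q) by (rewrite <- Rinv_1; apply Rinv_lt_contravar; lra). lra. }
exists (/ (/ q - 1)). intros n.
assert (B : 1 + INR n * (/ q - 1) <= (/ q) ^ n).
{ clear - P. induction n as [|n IH]; [simpl; lra|].
  rewrite S_INR. simpl.
  assert (0 <= INR n) by apply pos_INR.
  set (p := / q - 1) in *. replace (/ q) with (1 + p) in * by (unfold p; ring).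
  apply (Rmult_le_compat_l (1 + p)) in IH; [|lra].
  assert (0 <= INR n * (p * p)) by (apply Rmult_le_pos; nra). nra. }
rewrite pow_inv in B.
assert (Hp : 0 < q ^ n) by now apply pow_lt.
assert (INR n * (/ q - 1) * q ^ n <= 1).
{ apply (Rmult_le_compat_r (q ^ n)) in B; [|lra]. rewrite Rinv_l in B; [nra|lra]. }
apply (Rmult_le_reg_r (/ q - 1)); [exact P|]. rewrite Rinv_l; [|lra]. lra.
Qed.

Lemma subexp_taylor (h : C -> C) (a : nat -> C) : taylor h a -> subexp a.
Proof.
intros H r Hr.
assert (Hz : unit_disk r).
{ unfold unit_disk. rewrite Cmod_R, Rabs_pos_eq; lra. }
specialize (H r Hz). apply is_pseries_Cpow in H.
assert (Hex : ex_series (V := C_CompleteNormedModule) (fun n => Cpow r n * a n)%C) by (exists (h r); exact H).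
apply Cauchy_ex_series in Hex.
destruct (Hex (mkposreal 1 Rlt_0_1)) as [N HN].
assert (Hlast : forall n, (N <= n)%nat -> Cmod (a n) * r ^ n <= 1).
{ intros n Hn. specialize (HN n n Hn Hn). rewrite sum_n_n in HN.
  change (Cmod (Cpow r n * a n) < 1) in HN.
  rewrite Cmod_mult, Cmod_pow, Cmod_R, Rabs_pos_eq in HN; lra. }
clear HN.
assert (Hfin : forall m, exists M, forall n, (n < m)%nat -> Cmod (a n) * r ^ n <= M).
{ induction m as [|m [M IH]].
  - exists 0. intros; lia.
  - exists (Rmax M (Cmod (a m) * r ^ m)). intros n Hn.
    destruct (Nat.eq_dec n m) as [->|].
    + apply Rmax_r.
    + eapply Rle_trans; [apply IH; lia|apply Rmax_l]. }
destruct (Hfin N) as [M HM]. exists (Rmax M 1). intros n.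
destruct (Nat.lt_ge_cases n N) as [L|L].
- eapply Rle_trans; [now apply HM|apply Rmax_l].
- eapply Rle_trans; [now apply Hlast|apply Rmax_r].
Qed.

Lemma subexp_nat_mult (a : nat -> C) : subexp a -> subexp (fun n => INR n * a n)%C.
Proof.
intros H r [Hr0 Hr1].
(* r^n = s^n s^n: one factor bounds the coefficients, the other absorbs n. *)
set (s := sqrt r).
assert (Hs0 : 0 < s) by now apply sqrt_lt_R0.
assert (Hss : s * s = r) by (apply sqrt_sqrt; lra).
assert (Hs1 : s < 1) by nra.
destruct (H s (conj Hs0 Hs1)) as [M HM].
destruct (nat_mult_pow_bounded s (conj Hs0 Hs1)) as [M' HM'].
exists (M * M'). intros n.
rewrite Cmod_mult, Cmod_R, Rabs_pos_eq; [|apply pos_INR].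
rewrite <- Hss, Rpow_mult_distr.
replace (INR n * Cmod (a n) * (s ^ n * s ^ n)) with (Cmod (a n) * s ^ n * (INR n * s ^ n)) by ring.
assert (0 <= s ^ n) by (apply pow_le; lra).
apply Rmult_le_compat; [apply Rmult_le_pos; [apply Cmod_ge_0|assumption]
 |apply Rmult_le_pos; [apply pos_INR|assumption]|apply HM|apply HM'].
Qed.

Lemma subexp_shift (a : nat -> C) : subexp a -> subexp (fun n => a (S n)).
Proof.
intros H r Hr. destruct (H r Hr) as [M HM]. exists (M / r). intros n.
apply Rmult_le_reg_r with r; [lra|]. replace (M / r * r) with M by (field; lra).
specialize (HM (S n)). rewrite <- tech_pow_Rmult in HM. cbv beta. lra.
Qed.

Lemma subexp_ex_series (a : nat -> C) (z : C) :
  subexp a -> Cmod z < 1 -> exists l : C, is_cseries (fun n => Cpow z n * a n)%C l.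
Proof.
intros H Hz.
set (r := (1 + Cmod z) / 2). assert (0 <= Cmod z) by apply Cmod_ge_0.
assert (Hr : 0 < r < 1) by (unfold r; lra).
assert (Hzr : Cmod z < r) by (unfold r; lra).
destruct (H r Hr) as [M HM].
apply (ex_series_le (V := C_CompleteNormedModule) _ (fun n => M * (Cmod z / r) ^ n)).
- intros n. change (Cmod (Cpow z n * a n) <= M * (Cmod z / r) ^ n).
  rewrite Cmod_mult, Cmod_pow. unfold Rdiv. rewrite Rpow_mult_distr, pow_inv.
  assert (0 < r ^ n) by (apply pow_lt; lra).
  assert (0 <= Cmod z ^ n) by (apply pow_le; lra).
  replace (Cmod z ^ n * Cmod (a n)) with (Cmod (a n) * r ^ n * (Cmod z ^ n * / r ^ n)) by (field; lra).
  apply Rmult_le_compat_r; [|apply HM].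
  apply Rmult_le_pos; [assumption|]. left. now apply Rinv_0_lt_compat.
- apply (ex_series_scal (V := R_NormedModule)). apply ex_series_geom.
  rewrite Rabs_pos_eq; [apply Rlt_div_l; lra|]. apply Rdiv_le_0_compat; lra.
Qed.

(** Induction on the recursion [E], closed by n^2 + n <= (n + 1)^2. The factor r^2 on the left
    replaces an exponent n - 2; at n = 0 the truncated [pred] is harmless because its term has the
    coefficient 0. *)
Lemma Cpow_taylor2 (r : R) (z y : C) (n : nat) :
  0 < r -> Cmod z <= r -> Cmod y <= r ->
  Cmod (Cpow y n - Cpow z n - INR n * Cpow z (pred n) * (y - z)) * r ^ 2
    <= INR n ^ 2 * r ^ n * Cmod (y - z) ^ 2.
Proof.
intros Hr Hz Hy. induction n as [|n IH].
- simpl Cpow. simpl INR. replace (1 - 1 - 0 * 1 * (y - z))%C with (RtoC 0) by ring.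
  rewrite Cmod_0. simpl. lra.
- assert (E : (Cpow y (S n) - Cpow z (S n) - INR (S n) * Cpow z (pred (S n)) * (y - z))%C =
    (y * (Cpow y n - Cpow z n - INR n * Cpow z (pred n) * (y - z))
     + INR n * Cpow z (pred n) * ((y - z) * (y - z)))%C).
  { destruct n as [|n].
    - simpl. ring.
    - rewrite !S_INR, !RtoC_plus. simpl. ring. }
  rewrite E. set (e := (Cpow y n - Cpow z n - INR n * Cpow z (pred n) * (y - z))%C) in *.
  set (D := Cmod (y - z)) in *.
  assert (B : INR n * Cmod z ^ pred n * r <= INR n * r ^ n).
  { destruct n as [|n]; [simpl; lra|].
    rewrite Rmult_assoc. apply Rmult_le_compat_l; [apply pos_INR|].
    simpl. rewrite Rmult_comm. apply Rmult_le_compat_l; [lra|].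
    apply pow_incr. split; [apply Cmod_ge_0|exact Hz]. }
  eapply Rle_trans.
  { apply Rmult_le_compat_r; [apply pow2_ge_0|]. apply Cmod_triangle. }
  rewrite !Cmod_mult, Cmod_pow, Cmod_R, Rabs_pos_eq; [|apply pos_INR]. fold D.
  rewrite S_INR.
  assert (0 <= INR n) by apply pos_INR.
  assert (0 < r ^ n) by now apply pow_lt.
  assert (0 <= D) by apply Cmod_ge_0.
  assert (0 <= Cmod e) by apply Cmod_ge_0.
  assert (T1 : Cmod y * (Cmod e * r ^ 2) <= r * (INR n ^ 2 * r ^ n * D ^ 2)).
  { apply Rmult_le_compat; [apply Cmod_ge_0| |exact Hy|exact IH].
    apply Rmult_le_pos; [assumption|apply pow2_ge_0]. }
  assert (T2 : INR n * Cmod z ^ pred n * r * (r * D ^ 2) <= INR n * r ^ n * (r * D ^ 2)).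
  { apply Rmult_le_compat_r; [|exact B]. nra. }
  assert (0 <= r ^ n * r * D ^ 2) by (apply Rmult_le_pos; nra).
  simpl pow in *. nra.
Qed.

(** Term-by-term differentiation with an explicit bound K |y - z|^2 on the remainder: y ranges over
    the disc of radius r, while n^2 |a_n| is controlled at the larger radius r2 < 1, so that a
    geometric series in r / r2 dominates. *)
Lemma taylor_cderiv (h : C -> C) (a : nat -> C) (z : C) :
  taylor h a -> Cmod z < 1 ->
  exists l : C, cderiv h z l /\ is_cseries (fun n => Cpow z n * (INR (S n) * a (S n)))%C l.
Proof.
intros H Hz.
assert (Ha := subexp_taylor h a H).
assert (Ha1 := subexp_nat_mult a Ha).
destruct (subexp_ex_series _ z (subexp_shift _ Ha1) Hz) as [l Hl].
exists l; split; [|exact Hl].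
assert (Hl0 : is_cseries (fun n => INR n * Cpow z (pred n) * a n)%C l).
{ apply is_cseries_decr_1.
  replace (l - INR 0 * Cpow z (pred 0) * a 0%nat)%C with l by (simpl; ring).
  eapply (is_series_ext (V := C_NormedModule)); [|exact Hl].
  intros n. cbn [pred]. change (Cpow z n * (INR (S n) * a (S n)) = INR (S n) * Cpow z n * a (S n))%C. ring. }
set (r := (1 + Cmod z) / 2). assert (Pz : 0 <= Cmod z) by apply Cmod_ge_0.
set (r2 := (1 + r) / 2).
assert (Hr : 0 < r < r2 /\ r2 < 1 /\ Cmod z < r) by (unfold r2, r; lra).
destruct (subexp_nat_mult _ Ha1 r2) as [M HM]; [lra|].
assert (HM0 : 0 <= M).
{ specialize (HM 0%nat). simpl in HM. rewrite Cmult_0_l, Cmod_0 in HM. lra. }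
set (B := Series (fun n => (r / r2) ^ n)).
assert (HB : is_series (fun n => (r / r2) ^ n) B).
{ apply Series_correct, ex_series_geom. rewrite Rabs_pos_eq; [apply Rlt_div_l; lra|]. apply Rdiv_le_0_compat; lra. }
set (K := M / r ^ 2 * B).
assert (Hkey : forall y, Cmod y <= r -> Cmod (h y - h z - l * (y - z)) <= K * Cmod (y - z) ^ 2).
{ intros y Hy.
  assert (Sy := H y). assert (Sz := H z Hz).
  assert (Hyd : unit_disk y) by (unfold unit_disk; lra).
  specialize (Sy Hyd). apply is_pseries_Cpow in Sy. apply is_pseries_Cpow in Sz.
  apply (is_cseries_norm_le
    (fun n => (Cpow y n - Cpow z n - INR n * Cpow z (pred n) * (y - z)) * a n)%C
    (fun n => M / r ^ 2 * Cmod (y - z) ^ 2 * (r / r2) ^ n)).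
  - assert (S1 := is_series_minus _ _ _ _ Sy Sz).
    assert (S2 := is_series_scal (y - z)%C _ _ Hl0).
    assert (S3 := is_series_minus _ _ _ _ S1 S2).
    replace (h y - h z - l * (y - z))%C with
      (minus (G := C_NormedModule) (minus (G := C_NormedModule) (h y) (h z)) (scal (K := C_AbsRing) (V := C_NormedModule) (y - z)%C l)).
    + eapply is_series_ext; [|exact S3].
      intros n.
      change ((Cpow y n * a n + - (Cpow z n * a n)) + - ((y - z) * (INR n * Cpow z (pred n) * a n))
        = (Cpow y n - Cpow z n - INR n * Cpow z (pred n) * (y - z)) * a n)%C.
      ring.
    + change ((h y + - h z) + - ((y - z) * l) = h y - h z - l * (y - z))%C. ring.
  - intros n. rewrite Cmod_mult.
    assert (T := Cpow_taylor2 r z y n).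
    assert (Pr : 0 < r ^ 2) by (apply pow_lt; lra).
    set (e := (Cpow y n - Cpow z n - INR n * Cpow z (pred n) * (y - z))%C) in *.
    specialize (T ltac:(lra) ltac:(lra) Hy).
    specialize (HM n). rewrite !Cmod_mult, Cmod_R, Rabs_pos_eq in HM; [|apply pos_INR].
    unfold Rdiv. rewrite Rpow_mult_distr, pow_inv.
    assert (P2 : 0 < r2 ^ n) by (apply pow_lt; lra).
    assert (P1 : 0 < r ^ n) by (apply pow_lt; lra).
    apply (Rmult_le_reg_r (r ^ 2)); [exact Pr|].
    replace (M * / r ^ 2 * Cmod (y - z) ^ 2 * (r ^ n * / r2 ^ n) * r ^ 2)
      with (M / r2 ^ n * (r ^ n * Cmod (y - z) ^ 2)) by (field; lra).
    replace (Cmod e * Cmod (a n) * r ^ 2) with (Cmod (a n) * (Cmod e * r ^ 2)) by ring.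
    eapply Rle_trans; [apply Rmult_le_compat_l; [apply Cmod_ge_0|exact T]|].
    replace (Cmod (a n) * (INR n ^ 2 * r ^ n * Cmod (y - z) ^ 2))
     with (INR n * (INR n * Cmod (a n)) * (r ^ n * Cmod (y - z) ^ 2)) by ring.
    apply Rmult_le_compat_r.
    + apply Rmult_le_pos; [lra|apply pow2_ge_0].
    + apply Rmult_le_reg_r with (r2 ^ n); [exact P2|].
      replace (M / r2 ^ n * r2 ^ n) with M by (field; lra). exact HM.
  - unfold K. replace (M / r ^ 2 * B * Cmod (y - z) ^ 2) with (M / r ^ 2 * Cmod (y - z) ^ 2 * B) by ring.
    apply (is_series_scal (V := R_NormedModule) (M / r ^ 2 * Cmod (y - z) ^ 2)). exact HB. }
assert (PB : 0 <= B).
{ apply (is_cseries_norm_le (fun _ => RtoC 0) (fun n => (r / r2) ^ n) 0) in HB.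
  - now rewrite Cmod_0 in HB.
  - apply is_cseries_0.
  - intros n. rewrite Cmod_0. apply pow_le. apply Rdiv_le_0_compat; lra. }
assert (PK : 0 <= K).
{ apply Rmult_le_pos; [|exact PB]. apply Rdiv_le_0_compat; [exact HM0|apply pow_lt; lra]. }
intros eps He.
exists (Rmin (r - Cmod z) (eps / (K + 1))); split.
{ apply Rmin_pos; [lra|]. apply Rdiv_lt_0_compat; lra. }
intros y Hy.
assert (Hy1 : Cmod (y - z) < r - Cmod z) by (eapply Rlt_le_trans; [exact Hy|apply Rmin_l]).
assert (Hy2 : Cmod (y - z) < eps / (K + 1)) by (eapply Rlt_le_trans; [exact Hy|apply Rmin_r]).
apply Rlt_div_r in Hy2; [|lra].
eapply Rle_trans; [apply Hkey|].
- generalize (Cmod_minus_ge y z). lra.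
- generalize (Cmod_ge_0 (y - z)). set (D := Cmod (y - z)) in *. intros.
  simpl. nra.
Qed.

Lemma taylor_analytic (h : C -> C) (a : nat -> C) (z : C) :
  taylor h a -> Cmod z < 1 -> cderiv h z (C_derive h z).
Proof.
intros H Hz. destruct (taylor_cderiv h a z H Hz) as [l [Hl _]].
now rewrite (cderiv_C_derive _ _ _ Hl).
Qed.

Lemma taylor_C_derive (h : C -> C) (a : nat -> C) :
  taylor h a -> taylor (C_derive h) (fun n => INR (S n) * a (S n))%C.
Proof.
intros H z Hz. destruct (taylor_cderiv h a z H Hz) as [l [Hl Hs]].
rewrite (cderiv_C_derive _ _ _ Hl). now apply is_pseries_Cpow.
Qed.

Lemma taylor_0 (h : C -> C) (a : nat -> C) : taylor h a -> h 0 = a 0%nat.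
Proof.
intros H.
assert (Hz : unit_disk 0) by (unfold unit_disk; rewrite Cmod_0; lra).
specialize (H _ Hz). apply is_pseries_Cpow in H.
assert (K : is_cseries (fun n => Cpow 0 n * a n)%C (a 0%nat)).
{ apply is_cseries_decr_1.
  replace (a 0%nat - Cpow 0 0 * a 0%nat)%C with (RtoC 0) by (simpl; ring).
  apply (is_series_ext (V := C_NormedModule) (fun _ => RtoC 0)).
  - intros n. simpl. ring.
  - apply is_cseries_0. }
exact (is_cseries_unique _ _ _ H K).
Qed.

(** * Continuity, and minima of real parts *)

Lemma ccont_plus (f g : C -> C) (z : C) :
  ccont f z -> ccont g z -> ccont (fun y => f y + g y)%C z.
Proof.
intros Hf Hg eps He.
destruct (Hf (eps / 2)) as [d1 [Hd1 H1]]; [lra|].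
destruct (Hg (eps / 2)) as [d2 [Hd2 H2]]; [lra|].
exists (Rmin d1 d2); split; [now apply Rmin_pos|].
intros y Hy.
assert (A1 : Cmod (y - z) < d1) by (eapply Rlt_le_trans; [exact Hy|apply Rmin_l]).
assert (A2 : Cmod (y - z) < d2) by (eapply Rlt_le_trans; [exact Hy|apply Rmin_r]).
specialize (H1 y A1). specialize (H2 y A2).
replace (f y + g y - (f z + g z))%C with ((f y - f z) + (g y - g z))%C by ring.
eapply Rle_lt_trans; [apply Cmod_triangle|]. lra.
Qed.

Lemma ccont_conj (f : C -> C) (z : C) : ccont f z -> ccont (fun y => Cconj (f y)) z.
Proof.
intros Hf eps He. destruct (Hf eps He) as [d [Hd H]]. exists d; split; [exact Hd|].
intros y Hy. rewrite <- Cminus_conj, Cmod_conj. now apply H.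
Qed.

Lemma ccont_const (c z : C) : ccont (fun _ => c) z.
Proof. eapply cderiv_ccont, cderiv_const. Qed.

Lemma ccont_id (z : C) : ccont (fun y => y) z.
Proof. eapply cderiv_ccont, cderiv_id. Qed.

Lemma ccont_pow (f : C -> C) (z : C) (n : nat) :
  ccont f z -> ccont (fun y => Cpow (f y) n) z.
Proof.
intros H. induction n as [|n IH].
- exact (ccont_const 1 z).
- exact (ccont_mult f (fun y => Cpow (f y) n) z H IH).
Qed.

Lemma disc_min_Re (G : C -> C) (z0 : C) (rho : R) :
  0 <= rho -> (forall z, Cmod (z - z0) <= rho -> ccont G z) ->
  exists z, Cmod (z - z0) <= rho /\ forall y, Cmod (y - z0) <= rho -> Re (G z) <= Re (G y).
Proof.
intros Hrho HG. apply (disc_min (fun z => Re (G z))); [exact Hrho|].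
intros z Hz eps He. destruct (HG z Hz eps He) as [d [Hd H]]. exists d; split; [exact Hd|].
intros y _ Hy. eapply Rle_lt_trans; [|apply (H y Hy)].
change (Rabs (Re (G y - G z)) <= Cmod (G y - G z)). apply re_le_Cmod.
Qed.

Lemma Re_mult_conj (z : C) : Re (z * Cconj z) = Cmod z ^ 2.
Proof. rewrite <- Cmod2_conj. apply re_RtoC. Qed.

(** * Restriction to lines and the second-order condition *)

Lemma cderiv_line_Re (f : C -> C) (p v l : C) (s : R) :
  cderiv f (p + s * v) l -> derivable_pt_lim (fun t => Re (f (p + t * v)%C)) s (Re (l * v)).
Proof.
intros H eps He.
assert (Pv : 0 < Cmod v + 1) by (generalize (Cmod_ge_0 v); lra).
destruct (H (eps / 2 / (Cmod v + 1))) as [d [Hd H']].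
{ apply Rdiv_lt_0_compat; lra. }
assert (Hd' : 0 < d / (Cmod v + 1)) by now apply Rdiv_lt_0_compat.
exists (mkposreal _ Hd'). intros t Ht0 Ht. cbn [pos] in Ht.
assert (Pt : 0 < Rabs t) by now apply Rabs_pos_lt.
apply Rlt_div_r in Ht; [|exact Pv].
specialize (H' (p + (s + t)%R * v)%C).
replace (p + (s + t)%R * v - (p + s * v))%C with (t * v)%C in H' by (rewrite RtoC_plus; ring).
rewrite Cmod_mult, Cmod_R in H'.
assert (L : Rabs t * Cmod v < d) by nra.
specialize (H' L).
replace ((Re (f (p + (s + t)%R * v)%C) - Re (f (p + s * v)%C)) / t - Re (l * v))
  with (Re (f (p + (s + t)%R * v)%C - f (p + s * v)%C - l * (t * v)) / t)
  by (unfold Re; simpl; field; exact Ht0).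
unfold Rdiv. rewrite Rabs_mult, Rabs_inv.
apply Rmult_lt_reg_r with (Rabs t); [exact Pt|].
rewrite Rmult_assoc, Rinv_l, Rmult_1_r; [|lra].
eapply Rle_lt_trans; [apply re_le_Cmod|].
eapply Rle_lt_trans; [exact H'|].
assert (eps / 2 / (Cmod v + 1) * (Rabs t * Cmod v) <= eps / 2 * Rabs t).
{ replace (eps / 2 / (Cmod v + 1) * (Rabs t * Cmod v))
   with (eps / 2 * Rabs t * (Cmod v / (Cmod v + 1))) by (field; lra).
  rewrite <- (Rmult_1_r (eps / 2 * Rabs t)) at 2. apply Rmult_le_compat_l; [nra|].
  apply Rle_div_l; lra. }
nra.
Qed.

Lemma cderiv_line_Im (f : C -> C) (p v l : C) (s : R) :
  cderiv f (p + s * v) l -> derivable_pt_lim (fun t => Im (f (p + t * v)%C)) s (Im (l * v)).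
Proof.
intros H. apply (cderiv_scal (- Ci)%C) in H. apply cderiv_line_Re in H.
apply is_derive_Reals. apply is_derive_Reals in H.
replace (Im (l * v)) with (Re (- Ci * l * v)) by (unfold Re, Im; simpl; ring).
apply (is_derive_ext (fun t : R => Re (- Ci * f (p + t * v)%C))); [|exact H].
intros t. unfold Re, Im; simpl; ring.
Qed.

(** If c > 0, then psi lies above psi(0) just to the right of 0 and below it just to the left. So
    phi grows strictly when leaving 0 to the right if psi(0) >= 0, and to the left if psi(0) < 0. *)
Lemma second_derivative_at_max (phi psi : R -> R) (c d : R) :
  0 < d -> (forall s, Rabs s < d -> derivable_pt_lim phi s (psi s)) ->
  derivable_pt_lim psi 0 c -> (forall s, Rabs s < d -> phi s <= phi 0) -> c <= 0.
Proof.
intros Hd Hphi Hpsi Hmax. apply Rnot_lt_le; intros Hc.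
destruct (Hpsi (c / 2)) as [[d1 Hd1] H]; [lra|]. cbn [pos] in H.
assert (Hm : 0 < Rmin d d1) by now apply Rmin_pos.
set (m := Rmin d d1) in *.
assert (Hmd : m <= d) by apply Rmin_l. assert (Hmd1 : m <= d1) by apply Rmin_r.
assert (K : forall s, s <> 0 -> Rabs s < m -> 0 < (psi s - psi 0) / s).
{ intros s Hs Hsm. specialize (H s Hs ltac:(lra)). rewrite Rplus_0_l in H.
  apply Rabs_def2 in H. lra. }
destruct (Rle_lt_dec 0 (psi 0)) as [Hp|Hp].
- destruct (MVT_cor2 phi psi 0 (m / 2)) as [x [Hx1 Hx2]]; [lra| |].
  { intros x Hx. apply Hphi. rewrite Rabs_pos_eq; lra. }
  assert (Kx := K x ltac:(lra)). rewrite Rabs_pos_eq in Kx; [|lra]. specialize (Kx ltac:(lra)).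
  assert (0 < psi x - psi 0).
  { replace (psi x - psi 0) with ((psi x - psi 0) / x * x) by (field; lra). nra. }
  assert (M := Hmax (m / 2)). rewrite Rabs_pos_eq in M; [|lra]. specialize (M ltac:(lra)). nra.
- destruct (MVT_cor2 phi psi (- (m / 2)) 0) as [x [Hx1 Hx2]]; [lra| |].
  { intros x Hx. apply Hphi. rewrite Rabs_left1; lra. }
  assert (Kx := K x ltac:(lra)). rewrite Rabs_left in Kx; [|lra]. specialize (Kx ltac:(lra)).
  assert (psi x - psi 0 < 0).
  { replace (psi x - psi 0) with ((psi x - psi 0) / x * x) by (field; lra). nra. }
  assert (M := Hmax (- (m / 2))). rewrite Rabs_left in M; [|lra]. specialize (M ltac:(lra)). nra.
Qed.

(* [|T|^2 + e |z|^2] has Laplacian [4 |T'|^2 + 4 e > 0]. *)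
Lemma no_interior_max (T T1 : C -> C) (T2 p : C) (d e : R) :
  0 < d -> 0 < e -> (forall y, Cmod (y - p) < d -> cderiv T y (T1 y)) -> cderiv T1 p T2 ->
  (forall y, Cmod (y - p) < d -> Cmod (T y) ^ 2 + e * Cmod y ^ 2 <= Cmod (T p) ^ 2 + e * Cmod p ^ 2) ->
  False.
Proof.
intros Hd He HT HT1 Hmax.
assert (Hdir : forall v : C, Cmod v = 1 ->
  2 * (Re (T1 p * v) ^ 2 + Im (T1 p * v) ^ 2 + Re (T p) * Re (T2 * v * v)
       + Im (T p) * Im (T2 * v * v) + e * (Re v ^ 2 + Im v ^ 2)) <= 0).
{ intros v Hv.
  set (L := fun t : R => (p + t * v)%C).
  assert (HL : forall s, Cmod (L s - p) = Rabs s).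
  { intros s. unfold L. replace (p + s * v - p)%C with (s * v)%C by ring.
    rewrite Cmod_mult, Hv, Cmod_R. ring. }
  assert (L0 : L 0 = p) by (unfold L; ring).
  set (psi := fun s : R => 2 * (Re (T (L s)) * Re (T1 (L s) * v) + Im (T (L s)) * Im (T1 (L s) * v)
     + e * (Re (L s) * Re v + Im (L s) * Im v))).
  assert (DRe : forall s, is_derive (fun t => Re (L t)) s (Re v)).
  { intros s. apply is_derive_Reals. replace v with (1 * v)%C at 1 by ring.
    apply (cderiv_line_Re (fun y => y)), cderiv_id. }
  assert (DIm : forall s, is_derive (fun t => Im (L t)) s (Im v)).
  { intros s. apply is_derive_Reals. replace v with (1 * v)%C at 1 by ring.
    apply (cderiv_line_Im (fun y => y)), cderiv_id. }
  apply (second_derivative_at_max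
    (fun s => Re (T (L s)) * Re (T (L s)) + Im (T (L s)) * Im (T (L s))
      + e * (Re (L s) * Re (L s) + Im (L s) * Im (L s))) psi _ d Hd).
  - intros s Hs. apply is_derive_Reals.
    assert (D1 : is_derive (fun t => Re (T (L t))) s (Re (T1 (L s) * v))).
    { apply is_derive_Reals, cderiv_line_Re, HT. fold (L s). now rewrite HL. }
    assert (D2 : is_derive (fun t => Im (T (L t))) s (Im (T1 (L s) * v))).
    { apply is_derive_Reals, cderiv_line_Im, HT. fold (L s). now rewrite HL. }
    specialize (DRe s). specialize (DIm s).
    evar_last.
    { apply (is_derive_plus (V := R_NormedModule)); [apply (is_derive_plus (V := R_NormedModule))|].
      - apply (is_derive_mult _ _ _ _ _ D1 D1 Rmult_comm).
      - apply (is_derive_mult _ _ _ _ _ D2 D2 Rmult_comm).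
      - apply is_derive_scal. apply (is_derive_plus (V := R_NormedModule)).
        + apply (is_derive_mult _ _ _ _ _ DRe DRe Rmult_comm).
        + apply (is_derive_mult _ _ _ _ _ DIm DIm Rmult_comm). }
    unfold psi, plus, mult; simpl. ring.
  - apply is_derive_Reals.
    assert (Hp : cderiv T (p + 0%R * v) (T1 p)).
    { fold (L 0). rewrite L0. apply HT. rewrite Cminus_self, Cmod_0. exact Hd. }
    assert (Hp1 : cderiv (fun y => v * T1 y)%C (p + 0%R * v) (v * T2)).
    { fold (L 0). rewrite L0. now apply cderiv_scal. }
    assert (D1 := proj2 (is_derive_Reals _ _ _) (cderiv_line_Re _ _ _ _ _ Hp)).
    assert (D2 := proj2 (is_derive_Reals _ _ _) (cderiv_line_Im _ _ _ _ _ Hp)).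
    assert (D3 := proj2 (is_derive_Reals _ _ _) (cderiv_line_Re _ _ _ _ _ Hp1)).
    assert (D4 := proj2 (is_derive_Reals _ _ _) (cderiv_line_Im _ _ _ _ _ Hp1)).
    specialize (DRe 0). specialize (DIm 0).
    apply (is_derive_ext (fun s => 2 * (Re (T (L s)) * Re (v * T1 (L s)) + Im (T (L s)) * Im (v * T1 (L s))
      + e * (Re v * Re (L s) + Im v * Im (L s))))).
    { intros s. unfold psi. rewrite (Cmult_comm v).
      match goal with |- ?a = ?b => change (@eq R a b) end. ring. }
    evar_last.
    { apply is_derive_scal.
      apply (is_derive_plus (V := R_NormedModule)); [apply (is_derive_plus (V := R_NormedModule))|].
      - apply (is_derive_mult _ _ _ _ _ D1 D3 Rmult_comm).
      - apply (is_derive_mult _ _ _ _ _ D2 D4 Rmult_comm).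
      - apply is_derive_scal. apply (is_derive_plus (V := R_NormedModule)).
        + apply is_derive_scal. exact DRe.
        + apply is_derive_scal. exact DIm. }
    replace (p + 0%R * v)%C with p by (symmetry; apply L0).
    rewrite (Cmult_comm v (T1 p)), (Cmult_comm v T2). unfold plus, mult; simpl. ring.
  - intros s Hs. specialize (Hmax (L s)). rewrite HL in Hmax. specialize (Hmax Hs).
    rewrite !Cmod2_alt in Hmax. rewrite L0. nra. }
(* In the sum over the directions 1 and i the terms with [T2] cancel, which leaves 4 (|T1 p|^2 + e)
   <= 0. *)
assert (H1 := Hdir 1 Cmod_1). assert (H2 := Hdir Ci Cmod_Ci).
assert (Ci2 : (T2 * Ci * Ci)%C = (- T2)%C).
{ apply injective_projections; simpl; ring. }
rewrite Ci2 in H2. rewrite !Cmult_1_r in H1.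
unfold Re, Im in *; simpl in *. nra.
Qed.

(** * Maximum principle and Schwarz-Pick lemma *)

(** Two complex derivatives are what the second-order test on |T|^2 takes. As the derivatives are
    given as functions on U, the rules of calculus alone carry the property to products, powers and
    inverses. *)
Definition hol2 (U : C -> Prop) (f : C -> C) : Prop :=
  exists f1 f2 : C -> C, forall z, U z -> cderiv f z (f1 z) /\ cderiv f1 z (f2 z).

Lemma hol2_affine (U : C -> Prop) (a b : C) : hol2 U (fun y => a + b * y)%C.
Proof.
exists (fun _ => b), (fun _ => RtoC 0). intros z _. split; [apply cderiv_affine|apply cderiv_const].
Qed.

Lemma hol2_mult (U : C -> Prop) (f g : C -> C) :
  hol2 U f -> hol2 U g -> hol2 U (fun y => f y * g y)%C.
Proof.
intros [f1 [f2 Hf]] [g1 [g2 Hg]].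
exists (fun z => f1 z * g z + f z * g1 z)%C,
  (fun z => (f2 z * g z + f1 z * g1 z) + (f1 z * g1 z + f z * g2 z))%C.
intros z Hz. destruct (Hf z Hz) as [A1 A2]. destruct (Hg z Hz) as [B1 B2]. split.
- now apply cderiv_mult.
- apply cderiv_plus; now apply cderiv_mult.
Qed.

Lemma hol2_inv (U : C -> Prop) (f : C -> C) :
  (forall z, U z -> f z <> 0) -> hol2 U f -> hol2 U (fun y => / f y)%C.
Proof.
intros H0 [f1 [f2 Hf]].
exists (fun z => (-(1)) * f1 z / (f z * f z))%C,
  (fun z => ((-(1)) * f2 z * (f z * f z) - (-(1)) * f1 z * (f1 z * f z + f z * f1 z))
     / ((f z * f z) * (f z * f z)))%C.
intros z Hz. destruct (Hf z Hz) as [A1 A2]. specialize (H0 z Hz). split.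
- eapply cderiv_eq; [|apply cderiv_inv; eassumption]. field. exact H0.
- apply (cderiv_div (fun y => (-(1)) * f1 y)%C (fun y => f y * f y)%C).
  + now apply Cmult_neq_0.
  + now apply cderiv_scal.
  + now apply cderiv_mult.
Qed.

Lemma hol2_pow (U : C -> Prop) (f : C -> C) (n : nat) :
  hol2 U f -> hol2 U (fun y => Cpow (f y) n).
Proof.
intros H. induction n as [|n IH].
- exists (fun _ => RtoC 0), (fun _ => RtoC 0). intros z _.
  split; [exact (cderiv_const 1 z)|apply cderiv_const].
- exact (hol2_mult U f _ H IH).
Qed.

Lemma hol2_subset (U V : C -> Prop) (f : C -> C) :
  (forall z, V z -> U z) -> hol2 U f -> hol2 V f.
Proof. intros H [f1 [f2 Hf]]. exists f1, f2. auto. Qed.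

Lemma hol2_ext (U : C -> Prop) (f g : C -> C) :
  (forall z, U z -> exists d, 0 < d /\ forall y, Cmod (y - z) < d -> U y) ->
  (forall z, U z -> f z = g z) -> hol2 U f -> hol2 U g.
Proof.
intros HU E [f1 [f2 Hf]]. exists f1, f2. intros z Hz. split; [|now apply Hf].
destruct (HU z Hz) as [d [Hd H]].
apply (cderiv_local f g z _ d Hd); [auto|now apply Hf].
Qed.

(** At z0 only continuity is asked of T; a maximum there is harmless because T vanishes. The term e
    |z|^2 makes the function strictly subharmonic elsewhere, and e then tends to 0. *)
Lemma max_principle (T : C -> C) (z0 : C) (r B : R) :
  0 < r -> 0 <= B -> T z0 = 0 ->
  (forall z, Cmod z <= r -> ccont T z) ->
  hol2 (fun z => Cmod z < r /\ z <> z0) T ->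
  (forall z, Cmod z = r -> Cmod (T z) <= B) ->
  forall z, Cmod z <= r -> Cmod (T z) <= B.
Proof.
intros Hr HB H0 Hc [T1 [T2 HT]] Hbd z Hz.
assert (Key : forall e, 0 < e -> Cmod (T z) ^ 2 <= B ^ 2 + e * r ^ 2).
{ intros e He.
  set (G := fun y => ((-(1)) * (T y * Cconj (T y) + e * (y * Cconj y)))%C).
  assert (HG : forall y, Re (G y) = - (Cmod (T y) ^ 2 + e * Cmod y ^ 2)).
  { intros y. unfold G. rewrite <- !Cmod2_conj. rewrite <- RtoC_mult, <- RtoC_plus.
    rewrite re_scal_r. unfold Re; simpl; ring. }
  destruct (disc_min_Re G 0 r) as [p [Hp Hmin]]; [lra| |].
  { intros y Hy. unfold Cminus in Hy. rewrite Copp_0, Cplus_0_r in Hy.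
    apply (ccont_mult (fun _ => (-(1))%C)); [apply ccont_const|].
    apply ccont_plus.
    - apply ccont_mult; [now apply Hc|]. apply ccont_conj. now apply Hc.
    - apply (ccont_mult (fun _ => RtoC e)); [apply ccont_const|].
      apply ccont_mult; [apply ccont_id|]. apply ccont_conj, ccont_id. }
  assert (S0 : forall y : C, (y - 0)%C = y) by (intros; ring).
  rewrite S0 in Hp.
  assert (Hm : forall y, Cmod y <= r -> Cmod (T y) ^ 2 + e * Cmod y ^ 2 <= Cmod (T p) ^ 2 + e * Cmod p ^ 2).
  { intros y Hy. specialize (Hmin y). rewrite S0, !HG in Hmin. specialize (Hmin Hy). lra. }
  assert (HTp : Cmod (T p) <= B).
  { destruct (Req_dec (Cmod p) r) as [E|N]; [now apply Hbd|].
    destruct (classic (p = z0)) as [->|N0].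
    { rewrite H0, Cmod_0. exact HB. }
    exfalso.
    assert (Pz : 0 < Cmod (p - z0)).
    { apply Cmod_gt_0. intros E. apply N0. replace p with (p - z0 + z0)%C by ring. rewrite E. ring. }
    assert (Hin : forall y, Cmod (y - p) < Rmin (r - Cmod p) (Cmod (p - z0)) -> Cmod y < r /\ y <> z0).
    { intros y Hy. split.
      - generalize (Cmod_minus_ge y p) (Rmin_l (r - Cmod p) (Cmod (p - z0))). lra.
      - intros ->. rewrite Cmod_minus_sym in Hy.
        generalize (Rmin_r (r - Cmod p) (Cmod (p - z0))). lra. }
    assert (Pd : 0 < Rmin (r - Cmod p) (Cmod (p - z0))) by (apply Rmin_pos; lra).
    apply (no_interior_max T T1 (T2 p) p _ e Pd He).
    + intros y Hy. now apply HT, Hin.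
    + apply HT, Hin. rewrite Cminus_self, Cmod_0. exact Pd.
    + intros y Hy. apply Hm. destruct (Hin y Hy). lra. }
  specialize (Hm z Hz).
  assert (Cmod (T p) ^ 2 <= B ^ 2) by (apply pow_incr; split; [apply Cmod_ge_0|exact HTp]).
  assert (Cmod p ^ 2 <= r ^ 2) by (apply pow_incr; split; [apply Cmod_ge_0|exact Hp]).
  assert (0 <= Cmod z ^ 2) by apply pow2_ge_0. nra. }
apply Rnot_lt_le; intros Hlt.
(* This e makes the error e r^2 half of the alleged excess. *)
assert (P : 0 < (Cmod (T z) ^ 2 - B ^ 2) / (2 * r ^ 2)).
{ apply Rdiv_lt_0_compat; nra. }
specialize (Key _ P).
replace ((Cmod (T z) ^ 2 - B ^ 2) / (2 * r ^ 2) * r ^ 2) with ((Cmod (T z) ^ 2 - B ^ 2) / 2) in Key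
  by (field; lra). nra.
Qed.

(** The constants D and 2 disappear under n-th roots: for x > B the powers (x / B)^n would be
    unbounded. *)
Lemma le_of_pow_le (x B D : R) :
  0 < D -> 0 < B -> 0 <= x -> (forall n, x ^ n * D <= B ^ n * 2) -> x <= B.
Proof.
intros HD HB Hx H. apply Rnot_lt_le; intros Hlt.
assert (H1 : 1 < x / B) by (apply Rmult_lt_reg_r with B; [exact HB|];
  unfold Rdiv; rewrite Rmult_assoc, Rinv_l; lra).
destruct (Pow_x_infinity (x / B)) with (b := 3 / D) as [N HN].
{ rewrite Rabs_pos_eq; lra. }
specialize (HN N (Nat.le_refl N)). specialize (H N).
rewrite Rabs_pos_eq in HN; [|apply pow_le; lra].
replace ((x / B) ^ N) with (x ^ N * / B ^ N) in HN
  by (unfold Rdiv; rewrite Rpow_mult_distr, pow_inv; reflexivity).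
assert (PB : 0 < B ^ N) by now apply pow_lt.
apply Rge_le in HN.
apply (Rmult_le_compat_r (B ^ N * D)) in HN; [|nra].
replace (3 / D * (B ^ N * D)) with (3 * B ^ N) in HN by (field; lra).
replace (x ^ N * / B ^ N * (B ^ N * D)) with (x ^ N * D) in HN by (field; lra). lra.
Qed.

Definition dq (f : C -> C) (z0 l : C) (z : C) : C :=
  if excluded_middle_informative (z = z0) then l else ((f z - f z0) / (z - z0))%C.

Lemma dq_at (f : C -> C) (z0 l : C) : dq f z0 l z0 = l.
Proof. unfold dq. now destruct (excluded_middle_informative (z0 = z0)). Qed.

Lemma Cminus_neq (z w : C) : z <> w -> (z - w)%C <> 0.
Proof. intros H E. apply H. replace z with (z - w + w)%C by ring. rewrite E. ring. Qed.

Lemma dq_off (f : C -> C) (z0 l z : C) : z <> z0 -> dq f z0 l z = ((f z - f z0) / (z - z0))%C.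
Proof. intros H. unfold dq. now destruct (excluded_middle_informative (z = z0)). Qed.

Lemma dq_ccont (f : C -> C) (z0 l : C) : cderiv f z0 l -> ccont (dq f z0 l) z0.
Proof.
intros H eps He. destruct (H (eps / 2)) as [d [Hd H']]; [lra|].
exists d; split; [exact Hd|]. intros y Hy. rewrite dq_at.
destruct (classic (y = z0)) as [->|N].
- rewrite dq_at, Cminus_self, Cmod_0. exact He.
- rewrite dq_off by exact N. assert (N' := Cminus_neq _ _ N).
  replace ((f y - f z0) / (y - z0) - l)%C with ((f y - f z0 - l * (y - z0)) / (y - z0))%C by (field; exact N').
  rewrite Cmod_div by exact N'. specialize (H' y Hy).
  apply Cmod_gt_0 in N'.
  apply Rle_lt_trans with (eps / 2); [|lra].
  apply Rmult_le_reg_r with (Cmod (y - z0)); [exact N'|].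
  unfold Rdiv at 1. rewrite Rmult_assoc, Rinv_l, Rmult_1_r; lra.
Qed.

(** It measures how far k (u - v) / (k^2 - conj v u) is from the unit circle; for |v| < k this
    quotient maps the disc of radius k to the unit disc. *)
Lemma blaschke_identity (k : R) (u v : C) :
  Cmod (k ^ 2 - Cconj v * u) ^ 2 - k ^ 2 * Cmod (u - v) ^ 2
    = (k ^ 2 - Cmod v ^ 2) * (k ^ 2 - Cmod u ^ 2).
Proof. rewrite !Cmod2_alt. unfold Re, Im; simpl. ring. Qed.

Lemma pow2_le_inv (a b : R) : 0 <= b -> a ^ 2 <= b ^ 2 -> a <= b.
Proof. intros Hb H. apply Rnot_lt_le; intros L. nra. Qed.

(* The Blaschke quotient [q] is only known to be continuous at [z0], so the maximum
   principle is applied to [q^n (z - z0)], and then [n] tends to infinity. *)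
Lemma schwarz_pick_strict (om : C -> C) (k : R) (z0 l : C) :
  0 < k -> hol2 unit_disk om -> (forall z, unit_disk z -> Cmod (om z) < k) ->
  unit_disk z0 -> cderiv om z0 l ->
  Cmod l * (1 - Cmod z0 ^ 2) * k <= k ^ 2 - Cmod (om z0) ^ 2.
Proof.
intros Hk Hom Hb Hz0 Hl.
set (den := fun z => (k ^ 2 + (- Cconj (om z0)) * om z)%C).
assert (Hden : forall z, unit_disk z -> den z <> 0).
{ intros z Hz E. apply (f_equal Cmod) in E. rewrite Cmod_0 in E.
  assert (Cmod (k ^ 2) <= Cmod (Cconj (om z0) * om z)).
  { generalize (Cmod_minus_ge (k ^ 2) (Cconj (om z0) * om z)).
    replace (k ^ 2 - Cconj (om z0) * om z)%C with (den z) by (unfold den; ring). lra. }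
  rewrite Cmod_mult, Cmod_conj, Cmod_pow, Cmod_R, Rabs_pos_eq in H; [|lra].
  generalize (Hb z Hz) (Hb z0 Hz0) (Cmod_ge_0 (om z)) (Cmod_ge_0 (om z0)). nra. }
set (psi := fun z => (k * (1 + (- Cconj z0) * z) * / den z)%C).
assert (Hpsi : hol2 unit_disk psi).
{ apply (hol2_mult _ (fun z => k * (1 + (- Cconj z0) * z))%C (fun z => / den z)%C).
  - apply (hol2_mult _ (fun _ => RtoC k)); [|apply hol2_affine].
    exists (fun _ => RtoC 0), (fun _ => RtoC 0). intros; split; apply cderiv_const.
  - apply hol2_inv; [exact Hden|].
    destruct Hom as [o1 [o2 Ho]].
    exists (fun z => (- Cconj (om z0)) * o1 z)%C, (fun z => (- Cconj (om z0)) * o2 z)%C.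
    intros z Hz. destruct (Ho z Hz) as [A B]. split; [|now apply cderiv_scal].
    eapply cderiv_eq; [|apply cderiv_plus; [apply cderiv_const|apply cderiv_scal; exact A]]. ring. }
(* q is the quotient of k (om - om z0) / (k^2 - conj (om z0) om) by (z - z0) / (1 - conj z0 z), with
   its limit at z0; the claim is |q(z0)| <= 1. *)
set (q := fun z => (dq om z0 l z * psi z)%C).
set (U := fun z => unit_disk z /\ z <> z0).
assert (Hopen : forall z, U z -> exists d, 0 < d /\ forall y, Cmod (y - z) < d -> U y).
{ intros z [A N]. exists (Rmin (1 - Cmod z) (Cmod (z - z0))). split.
  - apply Rmin_pos; [unfold unit_disk in A; lra|]. now apply Cmod_gt_0, Cminus_neq.
  - intros y Hy. split.
    + unfold unit_disk. generalize (Cmod_minus_ge y z) (Rmin_l (1 - Cmod z) (Cmod (z - z0))). lra.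
    + intros ->. rewrite Cmod_minus_sym in Hy. generalize (Rmin_r (1 - Cmod z) (Cmod (z - z0))). lra. }
assert (Hq : hol2 U q).
{ apply hol2_mult; [|eapply hol2_subset; [|exact Hpsi]; now intros z []].
  apply (hol2_ext U (fun z => (om z + - om z0) * / (- z0 + 1 * z))%C); [exact Hopen| |].
  - intros z [_ N]. rewrite dq_off by exact N. unfold Cdiv, Cminus. f_equal. f_equal. ring.
  - apply hol2_mult.
    + destruct Hom as [o1 [o2 Ho]]. exists o1, o2. intros z [Hz _]. destruct (Ho z Hz) as [A B].
      split; [|exact B].
      eapply cderiv_eq; [|apply cderiv_plus; [exact A|apply cderiv_const]]. ring.
    + apply hol2_inv; [|apply hol2_affine]. intros z [_ N] E. apply N.
      replace z with (- z0 + 1 * z + z0)%C by ring. rewrite E. ring. }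
assert (Hqc0 : ccont q z0).
{ apply ccont_mult; [now apply dq_ccont|].
  destruct Hpsi as [p1 [p2 Hp]]. eapply cderiv_ccont. now apply Hp. }
assert (Hqc : forall z, unit_disk z -> ccont q z).
{ intros z Hz. destruct (classic (z = z0)) as [->|N]; [exact Hqc0|].
  destruct Hq as [q1 [q2 Hq]]. eapply cderiv_ccont. now apply (Hq z (conj Hz N)). }
assert (Hqid : forall z, unit_disk z -> z <> z0 -> Cmod (q z) * Cmod (z - z0) <= Cmod (1 - Cconj z0 * z)).
{ intros z Hz N. assert (N' := Cminus_neq _ _ N). assert (Nd := Hden z Hz).
  unfold q, psi. rewrite dq_off by exact N.
  rewrite <- Cmod_mult.
  replace ((om z - om z0) / (z - z0) * (k * (1 + - Cconj z0 * z) * / den z) * (z - z0))%C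
    with (k * (om z - om z0) * (1 - Cconj z0 * z) / den z)%C by (field; split; assumption).
  rewrite Cmod_div, !Cmod_mult, Cmod_R, Rabs_pos_eq by (assumption || lra).
  apply Cmod_gt_0 in Nd. apply Rmult_le_reg_r with (Cmod (den z)); [exact Nd|].
  unfold Rdiv. rewrite Rmult_assoc, Rinv_l, Rmult_1_r by lra.
  rewrite (Rmult_comm (Cmod (1 - _))). apply Rmult_le_compat_r; [apply Cmod_ge_0|].
  assert (I := blaschke_identity k (om z) (om z0)).
  replace (k ^ 2 - Cconj (om z0) * om z)%C with (den z) in I by (unfold den; ring).
  assert (0 <= (k ^ 2 - Cmod (om z0) ^ 2) * (k ^ 2 - Cmod (om z) ^ 2)).
  { generalize (Hb z Hz) (Hb z0 Hz0) (Cmod_ge_0 (om z)) (Cmod_ge_0 (om z0)). intros.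
    apply Rmult_le_pos; nra. }
  generalize (Cmod_ge_0 (om z - om z0)) (Cmod_ge_0 (den z)). nra. }
assert (Hq1 : forall z, unit_disk z -> z <> z0 -> Cmod (q z) <= 1).
{ intros z Hz N. apply Rnot_lt_le; intros Hlt.
  (* On |y| = r one has |1 - conj z0 y|^2 <= |y - z0|^2 + 1 - r^2 and |y - z0| >= r - |z0|. So |q|^2
     there is at most the left side of the last inequality, which tends to 1 as r does. *)
  assert (Hr : exists r, Cmod z < r < 1 /\ Cmod z0 < r /\
     1 + (1 - r ^ 2) / (r - Cmod z0) ^ 2 < Cmod (q z) ^ 2).
  { set (m := Rmax (Cmod z) (Cmod z0)).
    assert (Hm : 0 <= m < 1).
    { split; [apply Rle_trans with (Cmod z); [apply Cmod_ge_0|apply Rmax_l]|].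
      now apply Rmax_lub_lt. }
    set (c := (1 - m) / 2).
    set (x := Cmod (q z) ^ 2 - 1).
    assert (Hx : 0 < x) by (unfold x; nra).
    assert (Hc : 0 < c) by (unfold c; lra).
    set (de := Rmin c (x * c ^ 2 / 4)).
    assert (Hd : 0 < de).
    { apply Rmin_pos; [exact Hc|]. apply Rdiv_lt_0_compat; [|lra].
      apply Rmult_lt_0_compat; [exact Hx|]. now apply pow_lt. }
    assert (de <= c) by apply Rmin_l.
    assert (de <= x * c ^ 2 / 4) by apply Rmin_r.
    assert (Cmod z <= m) by apply Rmax_l. assert (Cmod z0 <= m) by apply Rmax_r.
    exists (1 - de). repeat split; [unfold c in *; lra|lra|unfold c in *; lra|].
    assert (Hrc : c <= 1 - de - Cmod z0) by (unfold c in *; lra).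
    assert (c ^ 2 <= (1 - de - Cmod z0) ^ 2) by (apply pow_incr; lra).
    assert (0 < c ^ 2) by now apply pow_lt.
    assert ((1 - (1 - de) ^ 2) / (1 - de - Cmod z0) ^ 2 < x); [|unfold x in *; lra].
    apply Rmult_lt_reg_r with ((1 - de - Cmod z0) ^ 2); [lra|].
    unfold Rdiv. rewrite Rmult_assoc, Rinv_l, Rmult_1_r by lra.
    apply Rlt_le_trans with (x * c ^ 2); [nra|]. apply Rmult_le_compat_l; lra. }
  destruct Hr as [r [[Hzr Hr1] [Hz0r Hr]]].
  assert (P0 : 0 <= Cmod z) by apply Cmod_ge_0.
  assert (P1 : 0 <= Cmod z0) by apply Cmod_ge_0.
  set (B := sqrt (1 + (1 - r ^ 2) / (r - Cmod z0) ^ 2)).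
  assert (PB : 0 <= (1 - r ^ 2) / (r - Cmod z0) ^ 2).
  { apply Rdiv_le_0_compat; [nra|]. apply pow_lt; lra. }
  assert (HB : 0 < B) by (apply sqrt_lt_R0; lra).
  assert (HBB : B ^ 2 = 1 + (1 - r ^ 2) / (r - Cmod z0) ^ 2) by (apply pow2_sqrt; lra).
  assert (HqB : Cmod (q z) <= B).
  { apply le_of_pow_le with (Cmod (z - z0)); [now apply Cmod_gt_0, Cminus_neq|exact HB|apply Cmod_ge_0|].
    intros n.
    set (T := fun y => (Cpow (q y) n * (- z0 + 1 * y))%C).
    assert (ET : forall y, Cmod (T y) = Cmod (q y) ^ n * Cmod (y - z0)).
    { intros y. unfold T. rewrite Cmod_mult, Cmod_pow. f_equal. f_equal. ring. }
    rewrite <- ET. apply (max_principle T z0 r); [lra| | | | | |lra].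
    - apply Rmult_le_pos; [|lra]. apply pow_le. lra.
    - unfold T. ring.
    - intros y Hy. apply ccont_mult.
      + apply ccont_pow, Hqc. unfold unit_disk. lra.
      + eapply cderiv_ccont. apply cderiv_affine.
    - apply (hol2_subset U).
      + intros y [A1 A2]. split; [unfold unit_disk; lra|exact A2].
      + apply hol2_mult; [now apply hol2_pow|apply hol2_affine].
    - intros y Hy. rewrite ET.
      assert (Hyd : unit_disk y) by (unfold unit_disk; lra).
      assert (Dy : r - Cmod z0 <= Cmod (y - z0)) by (rewrite <- Hy; apply Cmod_minus_ge).
      assert (Dy2 : Cmod (y - z0) <= 2).
      { eapply Rle_trans; [apply Cmod_triangle|]. rewrite Cmod_opp. lra. }
      assert (Ny : y <> z0).
      { intros E. rewrite E, Cminus_self, Cmod_0 in Dy. lra. }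
      apply Rmult_le_compat; [apply pow_le, Cmod_ge_0|apply Cmod_ge_0| |exact Dy2].
      apply pow_incr; split; [apply Cmod_ge_0|].
      specialize (Hqid y Hyd Ny).
      assert (I := blaschke_identity 1 y z0).
      replace (1 ^ 2 - Cconj z0 * y)%C with (1 - Cconj z0 * y)%C in I by (simpl; ring).
      rewrite Hy in I.
      set (X := Cmod (1 - Cconj z0 * y)) in *. set (Y := Cmod (y - z0)) in *.
      assert (Q : (Cmod (q y) * Y) ^ 2 <= Y ^ 2 + (1 - r ^ 2)).
      { apply Rle_trans with (X ^ 2).
        - apply pow_incr; split; [apply Rmult_le_pos; [apply Cmod_ge_0|lra]|exact Hqid].
        - assert (0 <= Cmod z0 ^ 2 * (1 - r ^ 2)) by (apply Rmult_le_pos; [apply pow2_ge_0|nra]). nra. }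
      assert (HBY : Y ^ 2 + (1 - r ^ 2) <= (B * Y) ^ 2).
      { rewrite Rpow_mult_distr, HBB.
        assert ((r - Cmod z0) ^ 2 <= Y ^ 2) by (apply pow_incr; lra).
        assert (0 < (r - Cmod z0) ^ 2) by (apply pow_lt; lra).
        assert ((1 - r ^ 2) <= (1 - r ^ 2) / (r - Cmod z0) ^ 2 * Y ^ 2).
        { apply Rle_trans with ((1 - r ^ 2) / (r - Cmod z0) ^ 2 * (r - Cmod z0) ^ 2).
          - apply Req_le. field. lra.
          - apply Rmult_le_compat_l; assumption. }
        lra. }
      apply Rmult_le_reg_r with Y; [lra|].
      apply pow2_le_inv; [apply Rmult_le_pos; lra|lra]. }
  assert (Cmod (q z) ^ 2 <= B ^ 2) by (apply pow_incr; split; [apply Cmod_ge_0|exact HqB]).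
  lra. }
(* At z0 itself the bound follows by continuity, along z0 + t with t > 0 small. *)
assert (Hq0 : Cmod (q z0) <= 1).
{ apply Rnot_lt_le; intros Hlt.
  destruct (Hqc0 (Cmod (q z0) - 1)) as [d [Hd H]]; [lra|].
  assert (Pm : 0 < Rmin d (1 - Cmod z0)) by (apply Rmin_pos; [exact Hd|unfold unit_disk in Hz0; lra]).
  set (t := Rmin d (1 - Cmod z0) / 2) in *.
  assert (Ht : 0 < t /\ t < d /\ t < 1 - Cmod z0).
  { generalize (Rmin_l d (1 - Cmod z0)) (Rmin_r d (1 - Cmod z0)). unfold t. lra. }
  assert (E : (z0 + t - z0)%C = t) by ring.
  specialize (H (z0 + t)%C). rewrite E, Cmod_R, Rabs_pos_eq in H by lra.
  specialize (H ltac:(lra)).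
  assert (Cmod (q (z0 + t)%C) <= 1).
  { apply Hq1.
    - unfold unit_disk. eapply Rle_lt_trans; [apply Cmod_triangle|]. rewrite Cmod_R, Rabs_pos_eq; lra.
    - intros E'. rewrite E', Cminus_self in E. apply RtoC_inj in E. lra. }
  generalize (Cmod_minus_ge (q z0) (q (z0 + t)%C)). rewrite Cmod_minus_sym. lra. }
assert (Nd := Hden z0 Hz0).
assert (Ed : den z0 = RtoC (k ^ 2 - Cmod (om z0) ^ 2)).
{ unfold den. rewrite RtoC_minus, Cmod2_conj, RtoC_pow. ring. }
assert (En : (1 + - Cconj z0 * z0)%C = RtoC (1 - Cmod z0 ^ 2)).
{ rewrite RtoC_minus, Cmod2_conj. ring. }
assert (Pd : 0 < k ^ 2 - Cmod (om z0) ^ 2).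
{ generalize (Hb z0 Hz0) (Cmod_ge_0 (om z0)). nra. }
assert (Pn : 0 < 1 - Cmod z0 ^ 2).
{ generalize (Cmod_ge_0 z0). unfold unit_disk in Hz0. nra. }
unfold q, psi in Hq0. rewrite dq_at, Ed, En, <- RtoC_inv, <- !RtoC_mult, Cmod_mult, Cmod_R, Rabs_pos_eq in Hq0.
- apply (Rmult_le_compat_r (k ^ 2 - Cmod (om z0) ^ 2)) in Hq0; [|lra].
  replace (Cmod l * (k * (1 - Cmod z0 ^ 2) * / (k ^ 2 - Cmod (om z0) ^ 2)) * (k ^ 2 - Cmod (om z0) ^ 2))
   with (Cmod l * (1 - Cmod z0 ^ 2) * k) in Hq0 by (field; lra). lra.
- apply Rmult_le_pos; [nra|]. left. now apply Rinv_0_lt_compat.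
- lra.
Qed.

(** The strict version applies with the bound k + t, and t tends to 0. This admits |om| = k, as for
    a constant dilatation. *)
Lemma schwarz_pick (om : C -> C) (k : R) (z0 l : C) :
  0 <= k -> hol2 unit_disk om -> (forall z, unit_disk z -> Cmod (om z) <= k) ->
  unit_disk z0 -> cderiv om z0 l ->
  Cmod l * (1 - Cmod z0 ^ 2) * k <= k ^ 2 - Cmod (om z0) ^ 2.
Proof.
intros Hk Hom Hb Hz0 Hl.
set (X := Cmod l * (1 - Cmod z0 ^ 2)). set (y := Cmod (om z0)).
assert (H : forall t, 0 < t -> X * (k + t) <= (k + t) ^ 2 - y ^ 2).
{ intros t Ht. apply schwarz_pick_strict; try assumption; [lra|].
  intros z Hz. specialize (Hb z Hz). lra. }
apply Rnot_lt_le; intros Hlt.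
set (D := X * k - (k ^ 2 - y ^ 2)).
assert (HD : 0 < D) by (unfold D; lra).
set (t := Rmin 1 (D / (2 * (2 * k + 1)))).
assert (Ht : 0 < t) by (apply Rmin_pos; [lra|apply Rdiv_lt_0_compat; lra]).
assert (t <= 1) by apply Rmin_l.
assert (t * (2 * (2 * k + 1)) <= D).
{ apply Rle_trans with (D / (2 * (2 * k + 1)) * (2 * (2 * k + 1))).
  - apply Rmult_le_compat_r; [lra|apply Rmin_r].
  - apply Req_le. field. lra. }
assert (0 <= X).
{ apply Rmult_le_pos; [apply Cmod_ge_0|]. generalize (Cmod_ge_0 z0). unfold unit_disk in Hz0. nra. }
specialize (H t Ht). unfold D in *. nra.
Qed.

(** * Linear invariance and the pre-Schwarzian *)

Lemma one_plus_neq0 (u : C) : Cmod u < 1 -> (1 + u)%C <> 0.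
Proof.
intros H E. assert (u = - (1))%C as Eu by (replace u with ((1 + u) - 1)%C by ring; rewrite E; ring).
rewrite Eu, Cmod_m1 in H. lra.
Qed.

Lemma Cmod_mult_lt1 (u v : C) : Cmod u < 1 -> Cmod v < 1 -> Cmod (u * v) < 1.
Proof. rewrite Cmod_mult. generalize (Cmod_ge_0 u) (Cmod_ge_0 v). nra. Qed.

Lemma Cmod_lt_iff (u v : C) : Cmod u ^ 2 < Cmod v ^ 2 -> Cmod u < Cmod v.
Proof. generalize (Cmod_ge_0 u) (Cmod_ge_0 v). nra. Qed.

Lemma disk_local (z : C) : unit_disk z ->
  0 < 1 - Cmod z /\ forall y, Cmod (y - z) < 1 - Cmod z -> unit_disk y.
Proof.
unfold unit_disk. intros H. split; [lra|]. intros y Hy. generalize (Cmod_minus_ge y z). lra.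
Qed.

Lemma unit_disk_0 : unit_disk 0.
Proof. unfold unit_disk. rewrite Cmod_0. lra. Qed.

Lemma mobius_denominator (a z : C) :
  Cmod a < 1 -> unit_disk z -> (1 + Cconj a * z)%C <> 0.
Proof. intros Ha Hz. apply one_plus_neq0, Cmod_mult_lt1; [now rewrite Cmod_conj|exact Hz]. Qed.

Lemma mobius_unit_disk (a z : C) :
  Cmod a < 1 -> unit_disk z -> unit_disk ((z + a) / (1 + Cconj a * z)).
Proof.
intros Ha Hz. assert (N := mobius_denominator a z Ha Hz).
unfold unit_disk in *. rewrite Cmod_div by exact N.
assert (N' := proj1 (Cmod_gt_0 _) N).
apply Rmult_lt_reg_r with (Cmod (1 + Cconj a * z)); [exact N'|].
unfold Rdiv. rewrite Rmult_assoc, Rinv_l, Rmult_1_l, Rmult_1_r by lra.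
apply Cmod_lt_iff.
assert (I := blaschke_identity 1 z (- a)).
replace (1 ^ 2 - Cconj (- a) * z)%C with (1 + Cconj a * z)%C in I
  by (rewrite Copp_conj; simpl; ring).
replace (z - - a)%C with (z + a)%C in I by ring. rewrite Cmod_opp in I.
assert (0 < (1 ^ 2 - Cmod a ^ 2) * (1 ^ 2 - Cmod z ^ 2)).
{ generalize (Cmod_ge_0 a) (Cmod_ge_0 z). intros. apply Rmult_lt_0_compat; nra. }
lra.
Qed.

Lemma mobius_cderiv (a z : C) :
  Cmod a < 1 -> unit_disk z ->
  cderiv (fun y => (y + a) / (1 + Cconj a * y))%C z
    ((1 - Cconj a * a) / ((1 + Cconj a * z) * (1 + Cconj a * z)))%C.
Proof.
intros Ha Hz. assert (N := mobius_denominator a z Ha Hz).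
eapply cderiv_eq; [|apply (cderiv_div (fun y => y + a)%C (fun y => 1 + Cconj a * y)%C);
  [exact N|apply cderiv_plus; [apply cderiv_id|apply cderiv_const]|apply cderiv_affine]].
field. exact N.
Qed.

Lemma taylor_coef2 (h : C -> C) (a : nat -> C) :
  taylor h a -> C_derive (C_derive h) 0 = (2 * a 2%nat)%C.
Proof.
intros H. assert (H2 := taylor_C_derive _ _ (taylor_C_derive _ _ H)).
rewrite (taylor_0 _ _ H2).
replace (INR 1) with 1 by reflexivity. replace (INR 2) with 2 by (simpl; ring). ring.
Qed.

(** The Koebe transform along the automorphism sending 0 to a has second derivative 2 c_2 at 0, and
    the chain rule turns this number into the expression on the left. *)
Lemma universal_LIF_preSchwarzian (alpha : R) (h : C -> C) (a : C) :
  universal_LIF alpha h -> unit_disk a ->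
  Cmod ((1 - Cconj a * a) * C_derive (C_derive h) a / C_derive h a - 2 * Cconj a) <= 2 * alpha.
Proof.
intros [M [[_ [Hnorm Hinv]] [Hord HM]]] Ha.
destruct (Hnorm h HM) as [_ [Hnz [b [Hb _]]]].
set (phi := fun y => ((y + a) / (1 + Cconj a * y))%C).
assert (Hphi : disk_automorphism phi).
{ exists 0, a. split; [exact Ha|]. intros z. rewrite cos_0, sin_0.
  change (phi z = 1 * phi z)%C. ring. }
assert (HK := Hinv h phi HM Hphi).
destruct (Hnorm _ HK) as [_ [_ [c [Hc _]]]].
assert (Hc2 : Cmod (c 2%nat) <= alpha).
{ destruct (Lub_Rbar_correct (fun x => exists (h : C -> C) (a : nat -> C),
    M h /\ taylor h a /\ x = Cmod (a 2%nat))) as [Hub _].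
  apply (Rbar_le_trans (Cmod (c 2%nat)) (family_order M) alpha); [|exact Hord].
  apply Hub. now exists (koebe_transform phi h), c. }
assert (phi0 : phi 0 = a) by (unfold phi; field; apply C1_nz).
set (n := (1 - Cconj a * a)%C).
assert (Hn : n <> 0).
{ unfold n. replace (Cconj a * a)%C with (RtoC (Cmod a ^ 2)) by (rewrite Cmod2_conj; ring).
  rewrite <- RtoC_minus. intros E. apply RtoC_inj in E.
  generalize (Cmod_ge_0 a). unfold unit_disk in Ha. nra. }
set (phi' := fun y => (n / ((1 + Cconj a * y) * (1 + Cconj a * y)))%C).
assert (Dphi : forall y, unit_disk y -> cderiv phi y (phi' y)).
{ intros y Hy. now apply mobius_cderiv. }
assert (phi'0 : phi' 0 = n) by (unfold phi'; field; apply C1_nz).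
assert (Dphi' : cderiv phi' 0 (- 2 * Cconj a * n)).
{ assert (N : (1 + Cconj a * 0)%C <> 0) by (rewrite Cmult_0_r, Cplus_0_r; apply C1_nz).
  eapply cderiv_eq; [|apply (cderiv_div (fun _ => n) (fun y => (1 + Cconj a * y) * (1 + Cconj a * y))%C);
   [now apply Cmult_neq_0|apply cderiv_const|
    apply (cderiv_mult (fun y => 1 + Cconj a * y)%C (fun y => 1 + Cconj a * y)%C); apply cderiv_affine]].
  cbv beta. rewrite Cmult_0_r, Cplus_0_r. field. }
set (cst := (C_derive h (phi 0) * C_derive phi 0)%C).
assert (Ecst : cst = (C_derive h a * n)%C).
{ unfold cst. rewrite phi0, (cderiv_C_derive _ _ _ (Dphi 0 unit_disk_0)), phi'0. reflexivity. }
assert (Hcst : cst <> 0).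
{ rewrite Ecst. apply Cmult_neq_0; [now apply Hnz|exact Hn]. }
assert (DK : forall y, unit_disk y ->
  C_derive (koebe_transform phi h) y = (/ cst * (C_derive h (phi y) * phi' y))%C).
{ intros y Hy. apply cderiv_C_derive.
  apply (cderiv_ext (fun z => / cst * (h (phi z) + - h (phi 0)))%C).
  { intros z. unfold koebe_transform. fold cst. unfold Cdiv, Cminus. ring. }
  apply cderiv_scal.
  eapply cderiv_eq; [|apply cderiv_plus; [|apply cderiv_const]; apply cderiv_comp;
    [apply (taylor_analytic h b); [exact Hb|now apply mobius_unit_disk]|now apply Dphi]].
  ring. }
assert (DDK : C_derive (C_derive (koebe_transform phi h)) 0 =
  (/ cst * ((C_derive (C_derive h) a * n) * n + C_derive h a * (- 2 * Cconj a * n)))%C).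
{ apply cderiv_C_derive.
  destruct (disk_local 0 unit_disk_0) as [P0 L0].
  eapply (cderiv_local _ _ _ _ _ P0).
  { intros y Hy. symmetry. apply DK, L0, Hy. }
  apply cderiv_scal. eapply cderiv_eq; [|apply cderiv_mult; [apply cderiv_comp|exact Dphi']].
  3: now apply Dphi, unit_disk_0.
  2: { rewrite phi0. eapply taylor_analytic; [eapply taylor_C_derive; exact Hb|exact Ha]. }
  cbv beta. rewrite phi0, phi'0. reflexivity. }
rewrite (taylor_coef2 _ _ Hc) in DDK.
replace (n * C_derive (C_derive h) a / C_derive h a - 2 * Cconj a)%C with (2 * c 2%nat)%C.
- rewrite Cmod_mult, Cmod_R, Rabs_pos_eq; lra.
- rewrite DDK, Ecst. field. split; [now apply Hnz|exact Hn].
Qed.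

Lemma dilatation_shift_bound (k t X : R) :
  0 < k < 1 -> 0 <= t <= k -> X * k <= k ^ 2 - t ^ 2 -> X / (1 - t) <= 2 * dilatation_shift k.
Proof.
intros Hk Ht HX. unfold dilatation_shift. destruct (Req_EM_T k 0) as [|_]; [lra|].
set (s := sqrt (1 - k ^ 2)).
assert (Hs : s ^ 2 = 1 - k ^ 2) by (apply pow2_sqrt; nra).
replace ((/ k) ^ 2 - 1) with ((1 - k ^ 2) / k ^ 2) by (field; lra).
rewrite sqrt_div_alt by nra. rewrite sqrt_pow2 by lra. fold s.
apply Rle_div_l; [lra|].
apply Rmult_le_reg_r with k; [lra|].
replace (2 * (/ k - s / k) * (1 - t) * k) with (2 * (1 - s) * (1 - t)) by (field; lra).
(* With k^2 = 1 - s^2 the two sides differ by exactly (s + t - 1)^2; the maximum is attained at t =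
   1 - s. *)
eapply Rle_trans; [exact HX|]. assert (0 <= (s + t - 1) ^ 2) by apply pow2_ge_0. nra.
Qed.

Lemma class_H_stable (alpha Q : R) (f : C -> C) :
  1 <= Q -> class_H alpha Q f ->
  exists h g h1 g1 h2 g2 : C -> C,
    (forall z, unit_disk z -> f z = (h z + Cconj (g z))%C) /\
    (forall z, unit_disk z -> cderiv h z (h1 z) /\ cderiv g z (g1 z) /\
       cderiv h1 z (h2 z) /\ cderiv g1 z (g2 z) /\ Cmod (g1 z) < Cmod (h1 z)) /\
    (forall eps z : C, Cmod eps = 1 -> unit_disk z ->
       Cmod ((1 - Cconj z * z) * (h2 z + eps * g2 z) / (h1 z + eps * g1 z) - 2 * Cconj z)
         <= 2 * (alpha + dilatation_shift (dilatation_bound Q))).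
Proof.
intros HQ [h [g [a [b [_ [_ [Ta [Tb [_ [_ [_ [Hf [Hsp [HU Hk]]]]]]]]]]]]]].
set (k := dilatation_bound Q) in *.
assert (Pk : 0 <= k < 1).
{ unfold k, dilatation_bound. split; [apply Rdiv_le_0_compat; lra|apply Rlt_div_l; lra]. }
assert (Ta1 := taylor_C_derive _ _ Ta). assert (Tb1 := taylor_C_derive _ _ Tb).
assert (Ta2 := taylor_C_derive _ _ Ta1). assert (Tb2 := taylor_C_derive _ _ Tb1).
exists h, g, (C_derive h), (C_derive g), (C_derive (C_derive h)), (C_derive (C_derive g)).
assert (Hlt : forall z, unit_disk z -> Cmod (C_derive g z) < Cmod (C_derive h z)).
{ intros z Hz. apply Cmod_lt_iff. specialize (Hsp z Hz). lra. }
assert (Hnz : forall z, unit_disk z -> C_derive h z <> 0).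
{ intros z Hz. apply Cmod_gt_0. generalize (Hlt z Hz) (Cmod_ge_0 (C_derive g z)). lra. }
split; [exact Hf|]. split.
{ intros z Hz. repeat split; try (eapply taylor_analytic; eassumption). now apply Hlt. }
intros eps z Heps Hz.
set (om := fun y => (C_derive g y * / C_derive h y)%C).
set (om' := ((C_derive (C_derive g) z * C_derive h z - C_derive g z * C_derive (C_derive h) z)
  / (C_derive h z * C_derive h z))%C).
assert (Hom : hol2 unit_disk om).
{ apply hol2_mult; [|apply hol2_inv; [exact Hnz|]].
  - exists (C_derive (C_derive g)), (C_derive (C_derive (C_derive g))).
    intros y Hy. split; eapply taylor_analytic; eassumption.
  - exists (C_derive (C_derive h)), (C_derive (C_derive (C_derive h))).
    intros y Hy. split; eapply taylor_analytic; eassumption. }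
assert (Dom : cderiv om z om').
{ apply cderiv_div; [now apply Hnz| |]; eapply taylor_analytic; eassumption. }
assert (SP : Cmod om' * (1 - Cmod z ^ 2) / (1 - Cmod (om z)) <= 2 * dilatation_shift k).
(* For k = 0 Schwarz-Pick reads 0 <= 0 and says nothing about om'; in that case om vanishes
   identically. *)
{ destruct (Req_dec k 0) as [K0|K0].
  - assert (Z : forall y, unit_disk y -> om y = 0).
    { intros y Hy. apply Cmod_eq_0. specialize (Hk y Hy). rewrite K0 in Hk.
      generalize (Cmod_ge_0 (om y)). unfold om, Cdiv in *. lra. }
    assert (E : om' = 0).
    { destruct (disk_local z Hz) as [P L].
      apply (cderiv_unique om z); [exact Dom|].
      apply (cderiv_local (fun _ => RtoC 0) _ _ _ _ P); [|apply cderiv_const].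
      intros y Hy. symmetry. apply Z, L, Hy. }
    rewrite E, K0, Cmod_0. unfold dilatation_shift. destruct (Req_EM_T 0 0); [|lra]. lra.
  - apply dilatation_shift_bound; [lra|split; [apply Cmod_ge_0|exact (Hk z Hz)]|].
    apply (schwarz_pick om); try assumption. lra. }
assert (Hom1 : Cmod (om z) < 1) by (specialize (Hk z Hz); unfold om, Cdiv in *; lra).
assert (Hc : C_derive h 0 <> 0) by (apply Hnz, unit_disk_0).
assert (PS := universal_LIF_preSchwarzian _ _ z HU Hz).
(* Dividing h by h'(0) leaves h''/h' unchanged. *)
assert (E1 : forall y, unit_disk y ->
  C_derive (fun z => h z / C_derive h 0)%C y = (/ C_derive h 0 * C_derive h y)%C).
{ intros y Hy. apply cderiv_C_derive.
  apply (cderiv_ext (fun z => / C_derive h 0 * h z)%C); [intros; unfold Cdiv; ring|].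
  apply cderiv_scal. eapply taylor_analytic; eassumption. }
assert (E2 : C_derive (C_derive (fun z => h z / C_derive h 0)%C) z
  = (/ C_derive h 0 * C_derive (C_derive h) z)%C).
{ apply cderiv_C_derive. destruct (disk_local z Hz) as [P L].
  eapply (cderiv_local _ _ _ _ _ P); [intros y Hy; symmetry; apply E1, L, Hy|].
  apply cderiv_scal. eapply taylor_analytic; eassumption. }
rewrite E1, E2 in PS by exact Hz.
assert (N1 := Hnz z Hz).
assert (N2 : (1 + eps * om z)%C <> 0).
{ apply one_plus_neq0. rewrite Cmod_mult, Heps. lra. }
assert (E3 : (C_derive h z + eps * C_derive g z)%C = (C_derive h z * (1 + eps * om z))%C).
{ unfold om. field. exact N1. }
assert (N3 : (C_derive h z + eps * C_derive g z)%C <> 0).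
{ rewrite E3. now apply Cmult_neq_0. }
(* Since (h + eps g)' = h' (1 + eps om), the pre-Schwarzian is h''/h' + eps om' / (1 + eps om); the
   last term is estimated through |1 + eps om| >= 1 - |om|. *)
replace ((1 - Cconj z * z) * (C_derive (C_derive h) z + eps * C_derive (C_derive g) z)
      / (C_derive h z + eps * C_derive g z) - 2 * Cconj z)%C
  with (((1 - Cconj z * z) * (/ C_derive h 0 * C_derive (C_derive h) z) / (/ C_derive h 0 * C_derive h z)
       - 2 * Cconj z) + (1 - Cconj z * z) * (eps * om') / (1 + eps * om z))%C.
2: { unfold om, om'. field. repeat split; assumption. }
eapply Rle_trans; [apply Cmod_triangle|].
rewrite Rmult_plus_distr_l. apply Rplus_le_compat; [exact PS|].
eapply Rle_trans; [|exact SP].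
rewrite Cmod_div by exact N2. rewrite !Cmod_mult, Heps, Rmult_1_l.
replace (1 - Cconj z * z)%C with (RtoC (1 - Cmod z ^ 2)) by (rewrite RtoC_minus, Cmod2_conj; ring).
assert (0 <= 1 - Cmod z ^ 2) by (generalize (Cmod_ge_0 z); unfold unit_disk in Hz; nra).
rewrite Cmod_R, Rabs_pos_eq by assumption. rewrite (Rmult_comm (Cmod om')).
apply Rmult_le_compat_l; [apply Rmult_le_pos; [assumption|apply Cmod_ge_0]|].
apply Rinv_le_contravar; [lra|].
generalize (Cmod_minus_ge 1 (- (eps * om z))). rewrite Cmod_1, Cmod_opp, Cmod_mult, Heps.
replace (1 - - (eps * om z))%C with (1 + eps * om z)%C by ring. lra.
Qed.

(** * Support lines of stable pairs *)

Lemma Re_mult_ge (x y : C) : - (Cmod x * Cmod y) <= Re (x * y).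
Proof.
generalize (re_le_Cmod (x * y)). rewrite Cmod_mult. intros H. apply Rabs_le_between in H. lra.
Qed.

(** With z = c + u and w = c + v the quantity is Re (S' + S phi) for S = (z - w) (rho^2 - conj v u),
    and |S| = X Y. Multiplying by M = 1 - |z|^2 and inserting the bound on M phi - 2 conj z reduces
    the claim to M Re S' + 2 Re (conj z S) > 2 A |S|. By [Key] the left side times rho^2 is at least
    (rho^2 + N) rho |S|, and rho^2 + N > 2 A rho is the hypothesis. *)
Lemma dilation_positive (A rho : R) (c u v phi : C) :
  0 < rho -> Cmod c + rho < 1 -> 0 < rho ^ 2 - 2 * A * rho + 1 - Cmod c ^ 2 ->
  Cmod u <= rho -> Cmod v < rho ->
  Cmod ((1 - Cconj (c + u) * (c + u)) * phi - 2 * Cconj (c + u)) <= 2 * A ->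
  0 < Re (rho ^ 2 + Cconj v * v - 2 * Cconj v * u + (u - v) * (rho ^ 2 - Cconj v * u) * phi).
Proof.
intros Hrho Hc HA Hu Hv Hphi.
set (M := 1 - Cmod (c + u) ^ 2).
set (a := rho ^ 2 + Cmod v ^ 2 - 2 * Re (Cconj v * u)).
set (St := ((u - v) * (rho ^ 2 - Cconj v * u))%C).
set (X := Cmod (rho ^ 2 - Cconj v * u)). set (Y := Cmod (u - v)).
set (N := 1 - Cmod c ^ 2). set (D := rho ^ 2 - Cmod u ^ 2). set (t := Re (Cconj c * v)).
assert (Pc := Cmod_ge_0 c). assert (Pu := Cmod_ge_0 u). assert (Pv := Cmod_ge_0 v).
assert (PX : 0 <= X) by apply Cmod_ge_0. assert (PY : 0 <= Y) by apply Cmod_ge_0.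
assert (HM : 0 < M).
{ assert (Cmod (c + u) < 1) by (eapply Rle_lt_trans; [apply Cmod_triangle|lra]).
  generalize (Cmod_ge_0 (c + u)). unfold M. nra. }
assert (HSt : Cmod St = X * Y) by (unfold St, X, Y; rewrite Cmod_mult; ring).
assert (Ea : a * rho ^ 2 = X ^ 2 + Cmod v ^ 2 * D).
{ unfold a, X, D. rewrite !Cmod2_alt. unfold Re, Im; simpl. ring. }
assert (EXY : X ^ 2 - (rho * Y) ^ 2 = (rho ^ 2 - Cmod v ^ 2) * D).
{ unfold X, Y, D. rewrite Rpow_mult_distr, !Cmod2_alt. unfold Re, Im; simpl. ring. }
assert (EG : a * M + 2 * Re (Cconj (c + u) * St)
   = a * (N - rho ^ 2) + X ^ 2 + (rho * Y) ^ 2 - 2 * D * t).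
{ unfold a, M, St, N, X, Y, D, t. rewrite Rpow_mult_distr, !Cmod2_alt. unfold Re, Im; simpl. ring. }
assert (Pa : 0 < a).
{ assert (Re (Cconj v * u) <= Cmod v * Cmod u).
  { rewrite <- (Cmod_conj v), <- Cmod_mult. eapply Rle_trans; [apply Rle_abs|apply re_le_Cmod]. }
  assert (Cmod v * Cmod u <= Cmod v * rho) by (apply Rmult_le_compat_l; lra).
  unfold a. assert (0 < (rho - Cmod v) ^ 2) by (apply pow_lt; lra). nra. }
assert (HD : 0 <= D) by (unfold D; nra).
(* An equality when |u| = rho. In general, with Z = rho Y, the sides differ by (N X - rho^2 Z) (X -
   Z) + D (|v|^2 (N - rho^2) - 2 rho^2 t); [F1] bounds the first term below by a multiple of D, and
   [F2] settles the sum. *)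
assert (Key : (rho ^ 2 + N) * (X * (rho * Y)) <= rho ^ 2 * (a * M + 2 * Re (Cconj (c + u) * St))).
{ rewrite EG. set (Z := rho * Y) in *. assert (PZ : 0 <= Z) by (apply Rmult_le_pos; lra).
  assert (HXZ : Z <= X).
  { apply pow2_le_inv; [exact PX|].
    assert (0 <= (rho ^ 2 - Cmod v ^ 2) * D) by (apply Rmult_le_pos; [nra|exact HD]). lra. }
  (* The difference is 1 - (|c| + rho)^2, positive because D(c, rho) lies well inside the unit
     disc. *)
  assert (HN : 2 * Cmod c * rho <= N - rho ^ 2) by (unfold N; nra).
  assert (Ht : t <= Cmod c * Cmod v).
  { unfold t. rewrite <- (Cmod_conj c), <- Cmod_mult. eapply Rle_trans; [apply Rle_abs|apply re_le_Cmod]. }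
  assert (PcR : 0 <= Cmod c * rho) by (apply Rmult_le_pos; lra).
  assert (F1 : (N - rho ^ 2) / 2 * (X + Z) * (X - Z) <= (N * X - rho ^ 2 * Z) * (X - Z)).
  { apply Rmult_le_compat_r; [lra|].
    assert (0 <= (N + rho ^ 2) * (X - Z)) by (apply Rmult_le_pos; [nra|lra]). nra. }
  replace ((N - rho ^ 2) / 2 * (X + Z) * (X - Z)) with ((N - rho ^ 2) / 2 * (X ^ 2 - Z ^ 2)) in F1 by field.
  rewrite EXY in F1.
  assert (F2 : 0 <= (N - rho ^ 2) / 2 * (rho ^ 2 + Cmod v ^ 2) - 2 * rho ^ 2 * t).
  { assert (Cmod c * rho * (rho ^ 2 + Cmod v ^ 2) <= (N - rho ^ 2) / 2 * (rho ^ 2 + Cmod v ^ 2)).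
    { apply Rmult_le_compat_r; [nra|lra]. }
    assert (2 * rho ^ 2 * t <= 2 * rho ^ 2 * (Cmod c * Cmod v)) by (apply Rmult_le_compat_l; [nra|exact Ht]).
    assert (0 <= Cmod c * rho * (rho - Cmod v) ^ 2) by (apply Rmult_le_pos; [exact PcR|apply pow2_ge_0]).
    nra. }
  assert (F3 := Rmult_le_pos _ _ HD F2).
  replace (rho ^ 2 * (a * (N - rho ^ 2) + X ^ 2 + Z ^ 2 - 2 * D * t))
    with (a * rho ^ 2 * (N - rho ^ 2) + rho ^ 2 * (X ^ 2 + Z ^ 2) - 2 * rho ^ 2 * D * t) by ring.
  rewrite Ea. nra. }
assert (E2 : 0 < a * M + 2 * Re (Cconj (c + u) * St) - 2 * A * (X * Y)).
(* Where S = 0 the strictness comes from a M > 0; elsewhere it comes from the hypothesis on rho,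
   multiplied by |S|. *)
{ destruct (Req_dec (X * Y) 0) as [E0|N0].
  - assert (St = 0) as -> by (apply Cmod_eq_0; rewrite HSt; exact E0).
    rewrite Cmult_0_r, E0. unfold Re at 1; simpl. nra.
  - assert (PXY : 0 < X * Y) by (assert (0 <= X * Y) by (apply Rmult_le_pos; assumption); lra).
    assert (2 * A * rho * (rho * (X * Y)) < (rho ^ 2 + N) * (rho * (X * Y))).
    { apply Rmult_lt_compat_r; [now apply Rmult_lt_0_compat|unfold N; lra]. }
    apply Rmult_lt_reg_l with (rho ^ 2); [now apply pow_lt|]. rewrite Rmult_0_r. nra. }
assert (Hre := Re_mult_ge St ((1 - Cconj (c + u) * (c + u)) * phi - 2 * Cconj (c + u))).
rewrite HSt in Hre.
assert (X * Y * Cmod ((1 - Cconj (c + u) * (c + u)) * phi - 2 * Cconj (c + u)) <= X * Y * (2 * A)).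
{ apply Rmult_le_compat_l; [now apply Rmult_le_pos|exact Hphi]. }
apply Rmult_lt_reg_l with M; [exact HM|]. rewrite Rmult_0_r.
replace (M * Re (rho ^ 2 + Cconj v * v - 2 * Cconj v * u + St * phi))
  with (a * M + 2 * Re (Cconj (c + u) * St)
     + Re (St * ((1 - Cconj (c + u) * (c + u)) * phi - 2 * Cconj (c + u)))).
- lra.
- unfold a, M, St. rewrite !Cmod2_alt. unfold Re, Im; simpl. ring.
Qed.

Lemma Re_pos_of_mult_pos (p P : C) (r : R) : (p * P)%C = RtoC r -> 0 < r -> 0 < Re P -> 0 < Re p.
Proof.
intros E Hr HP.
assert (E' : Re p * Cmod P ^ 2 = r * Re P).
{ rewrite Cmod2_alt. assert (E1 := f_equal Re E). assert (E2 := f_equal Im E).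
  unfold Re, Im in *; simpl in *.
  apply (f_equal (Rmult (snd P))) in E2. rewrite <- E1. lra. }
assert (0 <= Cmod P ^ 2) by apply pow2_ge_0. apply Rnot_le_lt; intros L. nra.
Qed.

(* [dilation_field c rho w] is, up to a positive factor, the generator of the
   hyperbolic dilations of the disc [D(c, rho)] that fix [w]. *)
Definition dilation_field (c : C) (rho : R) (w z : C) : C :=
  ((z - w) * (rho ^ 2 - Cconj (w - c) * (z - c)))%C.

Lemma dilation_factor_neq0 (c : C) (rho : R) (w z : C) :
  Cmod (w - c) < rho -> Cmod (z - c) <= rho -> (rho ^ 2 - Cconj (w - c) * (z - c))%C <> 0.
Proof.
intros Hw Hz E. apply (f_equal Cmod) in E. rewrite Cmod_0 in E.
generalize (Cmod_minus_ge (rho ^ 2) (Cconj (w - c) * (z - c))). rewrite E.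
rewrite Cmod_mult, Cmod_conj, Cmod_pow, Cmod_R.
generalize (Cmod_ge_0 (w - c)) (Cmod_ge_0 (z - c)). intros.
rewrite Rabs_pos_eq in H1 by lra. nra.
Qed.

Lemma dilation_field_neq0 (c : C) (rho : R) (w z : C) :
  Cmod (w - c) < rho -> Cmod (z - c) <= rho -> z <> w -> dilation_field c rho w z <> 0.
Proof.
intros Hw Hz N. apply Cmult_neq_0; [now apply Cminus_neq|now apply dilation_factor_neq0].
Qed.

(** On the circle rho^2 = (z - c) conj (z - c), so the second factor is (z - c) conj (z - w). As S
    is radial there, the conditions at a boundary minimum give the sign of S p'. *)
Lemma dilation_field_boundary (c : C) (rho : R) (w z : C) :
  Cmod (z - c) = rho -> dilation_field c rho w z = ((Cmod (z - w) ^ 2)%R * (z - c))%C.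
Proof.
intros <-. unfold dilation_field. rewrite <- RtoC_pow, !Cmod2_conj, !Cminus_conj. ring.
Qed.

(* The quotient [p] satisfies [p P + S p' = 1] with [Re P > 0], so a nonpositive
   minimum of [Re p] on the closed disc contradicts the first-order conditions. *)
Lemma quotient_positive (A rho : R) (c w : C) (F F1 F2 : C -> C) :
  0 < rho -> Cmod c + rho < 1 -> 0 < rho ^ 2 - 2 * A * rho + 1 - Cmod c ^ 2 ->
  (forall z, unit_disk z -> cderiv F z (F1 z) /\ cderiv F1 z (F2 z) /\ F1 z <> 0 /\
     Cmod ((1 - Cconj z * z) * F2 z / F1 z - 2 * Cconj z) <= 2 * A) ->
  Cmod (w - c) < rho ->
  forall z, Cmod (z - c) <= rho -> z <> w ->
    0 < Re ((F z - F w) / (dilation_field c rho w z * F1 z)).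
Proof.
intros Hrho Hc HA HF Hw.
assert (Hin : forall z, Cmod (z - c) <= rho -> unit_disk z).
{ intros z Hz. unfold unit_disk. generalize (Cmod_minus_ge z c). lra. }
set (sig := fun z => (rho ^ 2 - Cconj (w - c) * (z - c))%C).
assert (Hsig : forall z, Cmod (z - c) <= rho -> sig z <> 0).
{ intros z Hz. now apply dilation_factor_neq0. }
assert (Dsig : forall z, cderiv sig z (- Cconj (w - c))%C).
{ intros z. apply (cderiv_ext (fun y => (rho ^ 2 + Cconj (w - c) * c) + (- Cconj (w - c)) * y)%C).
  - intros y. unfold sig. ring.
  - apply cderiv_affine. }
(* [dq] fills in the value at w, where p = 1 / (rho^2 - |w - c|^2) > 0. *)
set (p := fun z => (dq F w (F1 w) z * / (sig z * F1 z))%C).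
assert (Doff : forall z, Cmod (z - c) <= rho -> z <> w ->
  p z = ((F z - F w) / (dilation_field c rho w z * F1 z))%C).
{ intros z Hz N. unfold p. rewrite dq_off by exact N. unfold dilation_field. fold (sig z).
  destruct (HF z (Hin z Hz)) as [_ [_ [N1 _]]]. field.
  repeat split; [exact N1|now apply Hsig|now apply Cminus_neq]. }
(* Differentiate p S F' = F - F(w) and divide by F'; the factor of p is S' + S F''/F'. *)
assert (Dp : forall z, Cmod (z - c) <= rho -> z <> w -> exists p',
  cderiv p z p' /\
  (p z * (rho ^ 2 + Cconj (w - c) * (w - c) - 2 * Cconj (w - c) * (z - c)
     + dilation_field c rho w z * (F2 z / F1 z)) + dilation_field c rho w z * p')%C = RtoC 1).
{ intros z Hz N. destruct (HF z (Hin z Hz)) as [D0 [D1 [N1 _]]].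
  assert (Nz := Cminus_neq _ _ N). assert (Ns := Hsig z Hz).
  eexists. split.
  - apply (cderiv_local (fun y => ((F y - F w) * / (y - w)) * / (sig y * F1 y))%C _ _ _ (Cmod (z - w))).
    + now apply Cmod_gt_0.
    + intros y Hy. unfold p. rewrite dq_off; [reflexivity|].
      intros ->. rewrite Cmod_minus_sym in Hy. lra.
    + apply cderiv_mult.
      * apply (cderiv_div (fun y => F y - F w)%C (fun y => y - w)%C); [exact Nz| |];
        apply cderiv_minus; (apply cderiv_const || exact D0 || apply cderiv_id).
      * apply (cderiv_inv (fun y => sig y * F1 y)%C); [now apply Cmult_neq_0|].
        apply cderiv_mult; [apply Dsig|exact D1].
  - cbv beta. rewrite Doff by assumption. unfold dilation_field. fold (sig z).
    assert (Es : (Cconj (w - c) * (z - c))%C = (rho ^ 2 - sig z)%C) by (unfold sig; ring).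
    assert (Es2 : (Cconj (w - c) * (w - c))%C = (rho ^ 2 - sig z - Cconj (w - c) * (z - w))%C)
      by (unfold sig; ring).
    replace (2 * Cconj (w - c) * (z - c))%C with (2 * (rho ^ 2 - sig z))%C by (rewrite <- Es; ring).
    rewrite Es2. field. repeat split; assumption. }
assert (Hpc : forall z, Cmod (z - c) <= rho -> ccont p z).
{ intros z Hz. destruct (classic (z = w)) as [->|N].
  - destruct (HF w (Hin w Hz)) as [D0 [D1 [N1 _]]].
    apply ccont_mult; [now apply dq_ccont|].
    eapply cderiv_ccont. apply (cderiv_inv (fun y => sig y * F1 y)%C).
    + apply Cmult_neq_0; [now apply Hsig|exact N1].
    + apply cderiv_mult; [apply Dsig|exact D1].
  - destruct (Dp z Hz N) as [p' [H _]]. eapply cderiv_ccont, H. }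
destruct (disc_min_Re p c rho) as [m [Hm Hmin]]; [lra|exact Hpc|].
assert (Hpos : 0 < Re (p m)).
{ destruct (classic (m = w)) as [->|N].
  - destruct (HF w (Hin w Hm)) as [_ [_ [N1 _]]].
    unfold p. rewrite dq_at.
    assert (Es : sig w = RtoC (rho ^ 2 - Cmod (w - c) ^ 2)).
    { unfold sig. rewrite RtoC_minus, Cmod2_conj, RtoC_pow. ring. }
    assert (P : 0 < rho ^ 2 - Cmod (w - c) ^ 2) by (generalize (Cmod_ge_0 (w - c)); nra).
    replace (F1 w * / (sig w * F1 w))%C with (/ sig w)%C.
    + rewrite Es, <- RtoC_inv by lra. rewrite re_RtoC. now apply Rinv_0_lt_compat.
    + field. split; [exact N1|now apply Hsig].
  - destruct (Dp m Hm N) as [p' [Dm Em]].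
    destruct (HF m (Hin m Hm)) as [_ [_ [N1 Hb]]].
    assert (HP := dilation_positive A rho c (m - c) (w - c) (F2 m / F1 m) Hrho Hc HA Hm Hw).
    replace (c + (m - c))%C with m in HP by ring.
    replace ((1 - Cconj m * m) * (F2 m / F1 m))%C with ((1 - Cconj m * m) * F2 m / F1 m)%C in HP
      by (unfold Cdiv; ring).
    specialize (HP Hb).
    replace ((m - c - (w - c)) * (rho ^ 2 - Cconj (w - c) * (m - c)))%C with (dilation_field c rho w m) in HP
      by (unfold dilation_field; ring).
    assert (Hr := cderiv_rdiff_Re _ _ _ Dm).
    destruct (Rle_lt_or_eq_dec _ _ Hm) as [L|E].
    + assert (Z := min_interior _ _ _ _ _ Hr L Hmin). rewrite Z, Cmult_0_r, Cplus_0_r in Em.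
      exact (Re_pos_of_mult_pos _ _ 1 Em Rlt_0_1 HP).
    (* On the circle S p' is real and at most 0, so p times a factor of positive real part is a real
       number at least 1. *)
    + destruct (min_boundary _ _ _ _ _ Hrho Hr E Hmin) as [I1 I2].
      assert (Ex : (p' * (m - c))%C = RtoC (Re (p' * (m - c)))).
      { apply injective_projections; [reflexivity|exact I1]. }
      assert (Es : (dilation_field c rho w m * p')%C
        = RtoC (Cmod (m - w) ^ 2 * Re (p' * (m - c)))).
      { rewrite (dilation_field_boundary _ _ _ _ E), RtoC_mult, <- Ex. ring. }
      rewrite Es in Em.
      refine (Re_pos_of_mult_pos _ _ (1 - Cmod (m - w) ^ 2 * Re (p' * (m - c))) _ _ HP).
      { rewrite RtoC_minus, <- Em. ring. }
      assert (0 <= Cmod (m - w) ^ 2) by apply pow2_ge_0. nra. }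
intros z Hz N. rewrite <- Doff by assumption. specialize (Hmin z Hz). lra.
Qed.

(** One bound for all rotations: [harmonic_support] picks [eps] from the direction of the normal,
    which varies with z and w. *)
Definition stable_pair (A : R) (h g h1 g1 h2 g2 : C -> C) : Prop :=
  (forall z, unit_disk z -> cderiv h z (h1 z) /\ cderiv g z (g1 z) /\
     cderiv h1 z (h2 z) /\ cderiv g1 z (g2 z) /\ Cmod (g1 z) < Cmod (h1 z)) /\
  (forall eps z : C, Cmod eps = 1 -> unit_disk z ->
     Cmod ((1 - Cconj z * z) * (h2 z + eps * g2 z) / (h1 z + eps * g1 z) - 2 * Cconj z) <= 2 * A).

(* With [e = N / |N|] the unit vector of the normal [N = S h' - conj (S g')], the
   number [conj e * S * (h + e^2 g)'] is a positive real and
   [Re (conj e * (f z - f w))] is the real part of [conj e] times the increment of [h + e^2 g]. *)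
Lemma harmonic_support (A rho : R) (c w z : C) (h g h1 g1 h2 g2 : C -> C) :
  stable_pair A h g h1 g1 h2 g2 ->
  0 < rho -> Cmod c + rho < 1 -> 0 < rho ^ 2 - 2 * A * rho + 1 - Cmod c ^ 2 ->
  Cmod (w - c) < rho -> Cmod (z - c) <= rho -> z <> w ->
  let S := dilation_field c rho w z in
  0 < Re (((h z + Cconj (g z)) - (h w + Cconj (g w))) * Cconj (S * h1 z - Cconj (S * g1 z))).
Proof.
intros [Hd Hst] Hrho Hc HA Hw Hz Nzw S.
assert (Hzd : unit_disk z) by (unfold unit_disk; generalize (Cmod_minus_ge z c); lra).
assert (NS : S <> 0) by now apply dilation_field_neq0.
assert (PS := proj1 (Cmod_gt_0 _) NS).
set (H := (S * h1 z)%C). set (G := (S * g1 z)%C).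
assert (HGH : Cmod G < Cmod H).
{ unfold H, G. rewrite !Cmod_mult. destruct (Hd z Hzd) as [_ [_ [_ [_ L]]]].
  now apply Rmult_lt_compat_l. }
set (N := (H - Cconj G)%C).
assert (PN : 0 < Cmod N).
{ generalize (Cmod_minus_ge H (Cconj G)). rewrite Cmod_conj. fold N. lra. }
set (e := (N / Cmod N)%C).
assert (NN : RtoC (Cmod N) <> 0) by (intros E; apply RtoC_inj in E; lra).
assert (EN : N = (Cmod N * e)%C) by (unfold e; field; exact NN).
assert (He : Cmod e = 1).
{ unfold e. rewrite Cmod_div by exact NN. rewrite Cmod_R, Rabs_pos_eq by lra. field. lra. }
assert (Ee : (Cconj e * e)%C = RtoC 1).
{ rewrite Cmult_comm, <- Cmod2_conj, He. f_equal. ring. }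
set (x := Re (Cconj e * H)). set (y := Re (e * G)). set (i := Im (e * G)).
assert (EH : (Cconj e * H)%C = (Cmod N + Cconj (e * G))%C).
{ replace H with (N + Cconj G)%C by (unfold N; ring). rewrite Cmult_conj, Cmult_plus_distr_l.
  f_equal. rewrite EN at 1. replace (Cconj e * (Cmod N * e))%C with (Cmod N * (Cconj e * e))%C by ring.
  rewrite Ee. ring. }
assert (Ex : x = Cmod N + y) by (unfold x; rewrite EH; unfold y, Re; simpl; ring).
assert (Ei : Im (Cconj e * H) = - i) by (rewrite EH; unfold i, Im; simpl; ring).
(* conj e H and e G have opposite imaginary parts, so |G| < |H| compares the real parts; together
   with x - y = |N| > 0 this gives x + y > 0. *)
assert (Hxy : y ^ 2 < x ^ 2).
{ assert (A1 : Cmod (e * G) ^ 2 = y ^ 2 + i ^ 2) by apply Cmod2_alt.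
  assert (A2 : Cmod (Cconj e * H) ^ 2 = x ^ 2 + i ^ 2).
  { rewrite Cmod2_alt, Ei. unfold x. ring. }
  rewrite Cmod_mult, He in A1. rewrite Cmod_mult, Cmod_conj, He in A2.
  generalize (Cmod_ge_0 G). nra. }
assert (Pnu : 0 < x + y) by nra.
set (F := fun t => (h t + e * e * g t)%C).
set (F1 := fun t => (h1 t + e * e * g1 t)%C).
set (F2 := fun t => (h2 t + e * e * g2 t)%C).
assert (Hee : Cmod (e * e) = 1) by (rewrite Cmod_mult, He; ring).
assert (HF : forall t, unit_disk t -> cderiv F t (F1 t) /\ cderiv F1 t (F2 t) /\ F1 t <> 0 /\
     Cmod ((1 - Cconj t * t) * F2 t / F1 t - 2 * Cconj t) <= 2 * A).
{ intros t Ht. destruct (Hd t Ht) as [D1 [D2 [D3 [D4 L]]]].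
  repeat split.
  - apply cderiv_plus; [exact D1|now apply cderiv_scal].
  - apply cderiv_plus; [exact D3|now apply cderiv_scal].
  - apply Cmod_gt_0. unfold F1. generalize (Cmod_minus_ge (h1 t) (- (e * e * g1 t))).
    rewrite Cmod_opp, Cmod_mult, Hee.
    replace (h1 t - - (e * e * g1 t))%C with (h1 t + e * e * g1 t)%C by ring. lra.
  - now apply Hst. }
assert (Q := quotient_positive A rho c w F F1 F2 Hrho Hc HA HF Hw z Hz Nzw). fold S in Q.
assert (NF1 : F1 z <> 0) by now apply HF.
(* The left side is conj e H + e G = |N| + 2 Re (e G). *)
assert (Enu : (Cconj e * (S * F1 z))%C = RtoC (x + y)).
{ replace (Cconj e * (S * F1 z))%C with (Cconj e * H + (Cconj e * e) * (e * G))%C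
    by (unfold F1, H, G; ring).
  rewrite Ee, EH. rewrite Ex. apply injective_projections; unfold y, Re; simpl; ring. }
assert (K : Re (Cconj e * (F z - F w)) = (x + y) * Re ((F z - F w) / (S * F1 z))).
{ rewrite <- re_scal_l, <- Enu. f_equal. field. split; assumption. }
assert (K2 : Re (Cconj e * (F z - F w)) = Re (Cconj e * ((h z + Cconj (g z)) - (h w + Cconj (g w))))).
{ replace (Cconj e * (F z - F w))%C with (Cconj e * (h z - h w) + (Cconj e * e) * (e * (g z - g w)))%C
    by (unfold F; ring).
  rewrite Ee. unfold Re; simpl; ring. }
fold H G N. rewrite EN, Cmult_conj.
replace (((h z + Cconj (g z)) - (h w + Cconj (g w))) * (Cconj (Cmod N) * Cconj e))%C
  with (Cmod N * (Cconj e * ((h z + Cconj (g z)) - (h w + Cconj (g w)))))%C.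
- rewrite re_scal_l, <- K2, K. now repeat apply Rmult_lt_0_compat.
- replace (Cconj (Cmod N)) with (RtoC (Cmod N)); [ring|].
  apply injective_projections; simpl; ring.
Qed.

(** * Convexity of the image *)

Lemma harmonic_increment (h g : C -> C) (z p q : C) :
  cderiv h z p -> cderiv g z q -> forall eps, 0 < eps -> exists d, 0 < d /\
  forall y, Cmod (y - z) < d ->
    Cmod ((h y + Cconj (g y)) - (h z + Cconj (g z)) - (p * (y - z) + Cconj (q * (y - z))))
      <= eps * Cmod (y - z).
Proof.
intros Hh Hg eps He.
destruct (Hh (eps / 2)) as [d1 [Hd1 H1]]; [lra|].
destruct (Hg (eps / 2)) as [d2 [Hd2 H2]]; [lra|].
exists (Rmin d1 d2); split; [now apply Rmin_pos|].
intros y Hy.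
assert (A1 : Cmod (y - z) < d1) by (eapply Rlt_le_trans; [exact Hy|apply Rmin_l]).
assert (A2 : Cmod (y - z) < d2) by (eapply Rlt_le_trans; [exact Hy|apply Rmin_r]).
specialize (H1 y A1). specialize (H2 y A2).
replace ((h y + Cconj (g y)) - (h z + Cconj (g z)) - (p * (y - z) + Cconj (q * (y - z))))%C
  with ((h y - h z - p * (y - z)) + Cconj (g y - g z - q * (y - z)))%C
  by (rewrite !Cminus_conj; ring).
eapply Rle_trans; [apply Cmod_triangle|]. rewrite Cmod_conj. lra.
Qed.

(** The differential is 2 Re (conj de (p s + conj (q s))) with de = f(z) - w0; moving the
    conjugation from q s to its factor makes the form complex-linear in s. *)
Lemma rdiff_dist2 (h g : C -> C) (z p q w0 : C) :
  cderiv h z p -> cderiv g z q ->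
  rdiff (fun y => Cmod (h y + Cconj (g y) - w0) ^ 2) z
    (2 * (Cconj (h z + Cconj (g z) - w0) * p + (h z + Cconj (g z) - w0) * q)).
Proof.
intros Hh Hg eps He.
set (de := (h z + Cconj (g z) - w0)%C).
set (K := Cmod p + Cmod q + 1).
assert (Pde : 0 <= Cmod de) by apply Cmod_ge_0.
assert (PK : 0 < K) by (unfold K; generalize (Cmod_ge_0 p) (Cmod_ge_0 q); lra).
set (e1 := Rmin 1 (eps / (4 * (Cmod de + 1)))).
assert (He1 : 0 < e1) by (apply Rmin_pos; [lra|apply Rdiv_lt_0_compat; lra]).
assert (He1' : e1 <= 1) by apply Rmin_l.
assert (He1'' : e1 * (4 * (Cmod de + 1)) <= eps).
{ apply Rle_trans with (eps / (4 * (Cmod de + 1)) * (4 * (Cmod de + 1))).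
  - apply Rmult_le_compat_r; [lra|apply Rmin_r].
  - apply Req_le. field. lra. }
destruct (harmonic_increment h g z p q Hh Hg e1 He1) as [d [Hd H]].
assert (PK2 : 0 < 2 * K ^ 2) by nra.
exists (Rmin d (eps / (2 * K ^ 2))); split.
{ apply Rmin_pos; [exact Hd|now apply Rdiv_lt_0_compat]. }
intros y Hy.
assert (A1 : Cmod (y - z) < d) by (eapply Rlt_le_trans; [exact Hy|apply Rmin_l]).
assert (A2 : Cmod (y - z) < eps / (2 * K ^ 2)) by (eapply Rlt_le_trans; [exact Hy|apply Rmin_r]).
apply Rlt_div_r in A2; [|exact PK2].
specialize (H y A1).
set (s := (y - z)%C) in *.
set (L := (p * s + Cconj (q * s))%C) in *.
set (De := ((h y + Cconj (g y)) - (h z + Cconj (g z)))%C) in *.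
set (r := (De - L)%C) in *.
assert (Ps : 0 <= Cmod s) by apply Cmod_ge_0.
assert (HDe : Cmod De <= K * Cmod s).
{ replace De with (L + r)%C by (unfold r; ring).
  eapply Rle_trans; [apply Cmod_triangle|].
  assert (Cmod L <= (Cmod p + Cmod q) * Cmod s).
  { eapply Rle_trans; [apply Cmod_triangle|]. rewrite Cmod_conj, !Cmod_mult. lra. }
  unfold K. nra. }
replace (h y + Cconj (g y) - w0)%C with (de + De)%C by (unfold de, De; ring).
replace (Cmod (de + De) ^ 2 - Cmod de ^ 2 - Re (2 * (Cconj de * p + de * q) * s))
  with (2 * Re (Cconj de * r) + Cmod De ^ 2).
2: { unfold r, L. rewrite !Cmod2_alt. unfold Re, Im; simpl. ring. }
eapply Rle_trans; [apply Rabs_triang|].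
rewrite Rabs_mult, (Rabs_pos_eq 2) by lra.
rewrite (Rabs_pos_eq (Cmod De ^ 2)) by apply pow2_ge_0.
assert (B1 : Rabs (Re (Cconj de * r)) <= Cmod de * (e1 * Cmod s)).
{ eapply Rle_trans; [apply re_le_Cmod|]. rewrite Cmod_mult, Cmod_conj.
  apply Rmult_le_compat_l; assumption. }
assert (B2 : Cmod De ^ 2 <= (K * Cmod s) ^ 2) by (apply pow_incr; split; [apply Cmod_ge_0|exact HDe]).
assert (B3 : 2 * (Cmod de * (e1 * Cmod s)) <= eps / 2 * Cmod s).
{ replace (2 * (Cmod de * (e1 * Cmod s))) with (2 * Cmod de * e1 * Cmod s) by ring.
  apply Rmult_le_compat_r; [exact Ps|]. nra. }
assert (B4 : (K * Cmod s) ^ 2 <= eps / 2 * Cmod s).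
{ replace ((K * Cmod s) ^ 2) with (K ^ 2 * Cmod s * Cmod s) by ring.
  apply Rmult_le_compat_r; [exact Ps|]. lra. }
lra.
Qed.

Lemma conj_pair_zero (de p q : C) :
  Cmod q < Cmod p -> (Cconj de * p + de * q)%C = 0 -> de = 0.
Proof.
intros H E. apply Cmod_eq_0.
assert (E' : (Cconj de * p)%C = (- (de * q))%C).
{ replace (Cconj de * p)%C with ((Cconj de * p + de * q) - de * q)%C by ring. rewrite E. ring. }
apply (f_equal Cmod) in E'. rewrite Cmod_opp, !Cmod_mult, Cmod_conj in E'.
generalize (Cmod_ge_0 de). nra.
Qed.

(** At an interior minimum of |f - w0|^2 the differential vanishes, which forces f(m) = w0 because
    |g'| < |h'| makes the differential of f invertible. On the circle mu acts as the multiplier of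
    the constraint. This serves both the openness and the convexity of the image. *)
Lemma harmonic_nearest (h g h1 g1 : C -> C) (c w0 : C) (rho : R) :
  0 < rho ->
  (forall z, Cmod (z - c) <= rho ->
     cderiv h z (h1 z) /\ cderiv g z (g1 z) /\ Cmod (g1 z) < Cmod (h1 z)) ->
  exists m, Cmod (m - c) <= rho /\
    (forall y, Cmod (y - c) <= rho ->
       Cmod (h m + Cconj (g m) - w0) <= Cmod (h y + Cconj (g y) - w0)) /\
    (h m + Cconj (g m) = w0 \/
     Cmod (m - c) = rho /\ exists mu : R, 0 < mu /\
       ((m - c) * (Cconj (w0 - (h m + Cconj (g m))) * h1 m
         + (w0 - (h m + Cconj (g m))) * g1 m) = mu))%C.
Proof.
intros Hrho Hd.
destruct (disc_min_Re (fun y => (h y + Cconj (g y) - w0) * Cconj (h y + Cconj (g y) - w0))%C c rho)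
  as [m [Hm Hmin]]; [lra| |].
{ intros z Hz. destruct (Hd z Hz) as [D1 [D2 _]].
  assert (K : ccont (fun y => h y + Cconj (g y) - w0)%C z).
  { apply ccont_plus; [|apply (ccont_const (- w0))].
    apply ccont_plus; [eapply cderiv_ccont, D1|apply ccont_conj; eapply cderiv_ccont, D2]. }
  apply ccont_mult; [exact K|now apply ccont_conj]. }
assert (Hmin' : forall y, Cmod (y - c) <= rho ->
  Cmod (h m + Cconj (g m) - w0) ^ 2 <= Cmod (h y + Cconj (g y) - w0) ^ 2).
{ intros y Hy. specialize (Hmin y Hy). now rewrite !Re_mult_conj in Hmin. }
exists m. split; [exact Hm|]. split.
{ intros y Hy. apply pow2_le_inv; [apply Cmod_ge_0|now apply Hmin']. }
destruct (Hd m Hm) as [D1 [D2 L]].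
assert (HU := rdiff_dist2 h g m _ _ w0 D1 D2).
set (de := (h m + Cconj (g m) - w0)%C) in *.
destruct (classic (de = 0)) as [Z|N].
{ left. replace (h m + Cconj (g m))%C with (de + w0)%C by (unfold de; ring). rewrite Z. ring. }
right.
assert (NB : (Cconj de * h1 m + de * g1 m)%C <> 0) by (intros E; apply N; eapply conj_pair_zero; eassumption).
destruct (Rle_lt_or_eq_dec _ _ Hm) as [Lt|E].
{ exfalso. apply NB. assert (Z := min_interior _ _ _ _ _ HU Lt Hmin').
  destruct (classic ((Cconj de * h1 m + de * g1 m)%C = 0)) as [|N']; [assumption|].
  exfalso. revert Z. apply Cmult_neq_0; [|exact N'].
  intros E. apply RtoC_inj in E. lra. }
split; [exact E|].
destruct (min_boundary _ _ _ _ _ Hrho HU E Hmin') as [I1 I2].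
set (B := (Cconj de * h1 m + de * g1 m)%C) in *.
exists (- Re (B * (m - c))).
assert (I3 : Im (B * (m - c)) = 0).
{ replace (2 * B * (m - c))%C with (2 * (B * (m - c)))%C in I1 by ring.
  unfold Im in *. simpl in *. lra. }
assert (I4 : Re (B * (m - c)) <= 0).
{ replace (2 * B * (m - c))%C with (2 * (B * (m - c)))%C in I2 by ring.
  rewrite re_scal_l in I2. lra. }
assert (EB : (B * (m - c))%C = RtoC (Re (B * (m - c)))).
{ apply injective_projections; [reflexivity|exact I3]. }
split.
- destruct (Req_dec (Re (B * (m - c))) 0) as [Z|]; [|lra].
  exfalso. rewrite Z in EB. revert EB. apply Cmult_neq_0; [exact NB|].
  apply Cmod_gt_0. lra.
- rewrite RtoC_opp, <- EB. unfold B.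
  replace (w0 - (h m + Cconj (g m)))%C with (- de)%C by (unfold de; ring).
  rewrite Copp_conj. ring.
Qed.

(** On a small circle |y - z| = r the linear part keeps f at distance at least k r from f(z). For w
    within k r / 2 of f(z) the nearest image point cannot come from that circle, so it is w
    itself. *)
Lemma harmonic_locally_onto (h g h1 g1 : C -> C) (z : C) (R0 : R) :
  0 < R0 ->
  (forall y, Cmod (y - z) < R0 ->
     cderiv h y (h1 y) /\ cderiv g y (g1 y) /\ Cmod (g1 y) < Cmod (h1 y)) ->
  exists d, 0 < d /\ forall w, Cmod (w - (h z + Cconj (g z))) < d ->
    exists y, Cmod (y - z) < R0 /\ w = (h y + Cconj (g y))%C.
Proof.
intros HR Hd.
destruct (Hd z) as [D1 [D2 L]]; [rewrite Cminus_self, Cmod_0; exact HR|].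
set (k := (Cmod (h1 z) - Cmod (g1 z)) / 2).
assert (Hk : 0 < k) by (unfold k; lra).
destruct (harmonic_increment h g z _ _ D1 D2 k Hk) as [d [Hdd Hinc]].
set (r := Rmin d R0 / 2).
assert (Hr : 0 < r /\ r < d /\ r < R0).
{ assert (0 < Rmin d R0) by now apply Rmin_pos.
  generalize (Rmin_l d R0) (Rmin_r d R0). unfold r. lra. }
assert (Hcirc : forall y, Cmod (y - z) = r ->
  k * r <= Cmod ((h y + Cconj (g y)) - (h z + Cconj (g z)))).
{ intros y Hy. specialize (Hinc y ltac:(lra)). rewrite Hy in Hinc.
  set (De := ((h y + Cconj (g y)) - (h z + Cconj (g z)))%C) in *.
  set (Ln := (h1 z * (y - z) + Cconj (g1 z * (y - z)))%C) in *.
  assert (A1 : Cmod Ln - Cmod De <= Cmod (De - Ln)) by (rewrite Cmod_minus_sym; apply Cmod_minus_ge).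
  assert (A2 : 2 * k * r <= Cmod Ln).
  { generalize (Cmod_minus_ge (h1 z * (y - z)) (- Cconj (g1 z * (y - z)))).
    replace (h1 z * (y - z) - - Cconj (g1 z * (y - z)))%C with Ln by (unfold Ln; ring).
    rewrite Cmod_opp, Cmod_conj, !Cmod_mult, Hy. unfold k. lra. }
  lra. }
assert (Pkr : 0 < k * r) by (apply Rmult_lt_0_compat; lra).
exists (k * r / 2). split; [lra|].
intros w Hw.
destruct (harmonic_nearest h g h1 g1 z w r) as [m [Hm [Hmin Hor]]]; [lra| |].
{ intros y Hy. apply Hd. lra. }
assert (Hmc := Hmin z). rewrite Cminus_self, Cmod_0 in Hmc. specialize (Hmc ltac:(lra)).
rewrite (Cmod_minus_sym (h z + _)) in Hmc.
destruct Hor as [E|[E _]].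
- exists m. split; [lra|now rewrite E].
- exfalso. specialize (Hcirc m E).
  generalize (Cmod_minus_triangle (h m + Cconj (g m)) w (h z + Cconj (g z))). lra.
Qed.

Lemma stable_convex_in_disk (A R0 : R) (c : C) (f h g h1 g1 h2 g2 : C -> C) :
  stable_pair A h g h1 g1 h2 g2 ->
  (forall z, unit_disk z -> f z = (h z + Cconj (g z))%C) ->
  0 < R0 ->
  (forall rho, 0 < rho < R0 -> Cmod c + rho < 1 /\ 0 < rho ^ 2 - 2 * A * rho + 1 - Cmod c ^ 2) ->
  convex_in_disk f c R0.
Proof.
intros Hst Hf HR Hrho.
(* Two given points lie in a disc of radius rho < R0, whose closure stays inside D(c, R0). *)
assert (Hrad : forall z1 z2, in_disk c R0 z1 -> in_disk c R0 z2 ->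
  exists rho, 0 < rho < R0 /\ Cmod (z1 - c) < rho /\ Cmod (z2 - c) < rho).
{ intros z1 z2 H1 H2. unfold in_disk in *.
  exists ((Rmax (Cmod (z1 - c)) (Cmod (z2 - c)) + R0) / 2).
  assert (Rmax (Cmod (z1 - c)) (Cmod (z2 - c)) < R0) by now apply Rmax_lub_lt.
  generalize (Rmax_l (Cmod (z1 - c)) (Cmod (z2 - c))) (Rmax_r (Cmod (z1 - c)) (Cmod (z2 - c)))
    (Cmod_ge_0 (z1 - c)). lra. }
assert (Hin : forall z, in_disk c R0 z -> unit_disk z).
{ intros z Hz. destruct (Hrad z z Hz Hz) as [rho [Hr [Hzr _]]].
  destruct (Hrho rho Hr) as [H1 _]. unfold unit_disk. generalize (Cmod_minus_ge z c). lra. }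
split; [exact Hin|]. split; [|split; [|split]].
- intros z1 z2 H1 H2 E. apply NNPP; intros N.
  destruct (Hrad z1 z2 H1 H2) as [rho [Hr [Hz1 Hz2]]].
  destruct (Hrho rho Hr) as [Hc HA].
  assert (K := harmonic_support A rho c z2 z1 h g h1 g1 h2 g2 Hst (proj1 Hr) Hc HA Hz2 (Rlt_le _ _ Hz1) N).
  cbv zeta in K. rewrite <- (Hf z1 (Hin z1 H1)), <- (Hf z2 (Hin z2 H2)), E, Cminus_self, Cmult_0_l in K.
  rewrite re_RtoC in K. lra.
- exists (f c), c. split; [|reflexivity]. unfold in_disk. rewrite Cminus_self, Cmod_0. exact HR.
- intros w [z [Hz ->]].
  destruct (harmonic_locally_onto h g h1 g1 z (R0 - Cmod (z - c))) as [d [Hd H]].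
  { unfold in_disk in Hz. lra. }
  { intros y Hy. assert (Hyd : unit_disk y).
    { apply Hin. unfold in_disk. generalize (Cmod_minus_triangle y z c). lra. }
    destruct (proj1 Hst y Hyd) as [D1 [D2 [_ [_ L]]]]. repeat split; assumption. }
  assert (Hd2 : 0 < d / 2) by lra.
  exists (mkposreal _ Hd2). intros w [B1 B2].
  destruct (H w) as [y [Hy E]].
  { rewrite <- (Hf z (Hin z Hz)). eapply Rle_lt_trans; [apply Cmod_le_abs|].
    change (Rabs (fst w - fst (f z)) < d / 2) in B1.
    change (Rabs (snd w - snd (f z)) < d / 2) in B2.
    change (Rabs (fst w - fst (f z)) + Rabs (snd w - snd (f z)) < d). lra. }
  assert (Hyc : in_disk c R0 y).
  { unfold in_disk. generalize (Cmod_minus_triangle y z c). lra. }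
  exists y. split; [exact Hyc|]. rewrite E. symmetry. now apply Hf, Hin.
- intros w1 w2 t [z1 [H1 ->]] [z2 [H2 ->]] Ht.
  destruct (Hrad z1 z2 H1 H2) as [rho [Hr [Hz1 Hz2]]].
  destruct (Hrho rho Hr) as [Hc HA].
  assert (Hind : forall z, Cmod (z - c) <= rho -> in_disk c R0 z) by (intros z Hz; unfold in_disk; lra).
  set (w0 := (t * f z1 + (1 - t)%R * f z2)%C).
  destruct (harmonic_nearest h g h1 g1 c w0 rho) as [m [Hm [_ Hor]]]; [lra| |].
  { intros z Hz. destruct (proj1 Hst z (Hin z (Hind z Hz))) as [D1 [D2 [_ [_ L]]]]. repeat split; assumption. }
  exists m. split; [now apply Hind|]. rewrite (Hf m (Hin m (Hind m Hm))).
  destruct Hor as [E|[E [mu [Hmu Emu]]]]; [now symmetry|exfalso].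
  set (H := ((m - c) * h1 m)%C). set (G := ((m - c) * g1 m)%C).
  set (fm := (h m + Cconj (g m))%C) in *.
  (* As m lies on the circle, S = |m - z|^2 (m - c) and the positive factor drops out: one normal at
     f(m) serves all z. *)
  assert (Hsup : forall z, in_disk c R0 z -> Cmod (z - c) < rho -> 0 < Re ((fm - f z) * Cconj (H - Cconj G))).
  { intros z Hz Hzr.
    assert (N : m <> z) by (intros <-; lra).
    assert (K := harmonic_support A rho c z m h g h1 g1 h2 g2 Hst (proj1 Hr) Hc HA Hzr Hm N).
    cbv zeta in K. rewrite <- (Hf z (Hin z Hz)) in K. fold fm in K.
    rewrite (dilation_field_boundary _ _ _ _ E) in K.
    set (k := Cmod (m - z) ^ 2) in K.
    assert (Pk : 0 <= k) by apply pow2_ge_0.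
    replace ((fm - f z) * Cconj (k * (m - c) * h1 m - Cconj (k * (m - c) * g1 m)))%C
      with (k * ((fm - f z) * Cconj (H - Cconj G)))%C in K.
    - rewrite re_scal_l in K. nra.
    - unfold H, G. apply injective_projections; simpl; ring. }
  assert (K1 := Hsup z1 H1 Hz1). assert (K2 := Hsup z2 H2 Hz2).
  set (Nn := (H - Cconj G)%C) in *.
  (* The convex combination w0 lies strictly on the inner side of the supporting line. *)
  assert (K : 0 < Re ((fm - w0) * Cconj Nn)).
  { replace ((fm - w0) * Cconj Nn)%C
      with (t * ((fm - f z1) * Cconj Nn) + (1 - t)%R * ((fm - f z2) * Cconj Nn))%C
      by (unfold w0; rewrite RtoC_minus; ring).
    replace (Re (t * ((fm - f z1) * Cconj Nn) + (1 - t)%R * ((fm - f z2) * Cconj Nn)))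
      with (t * Re ((fm - f z1) * Cconj Nn) + (1 - t) * Re ((fm - f z2) * Cconj Nn))
      by (unfold Re; simpl; ring).
    destruct (Req_dec t 0) as [->|]; [lra|]. nra. }
  set (u := (w0 - fm)%C) in *.
  set (J := Cmod H ^ 2 - Cmod G ^ 2).
  assert (HJ : 0 < J).
  { assert (Cmod G < Cmod H).
    { unfold G, H. rewrite !Cmod_mult, E.
      destruct (proj1 Hst m (Hin m (Hind m Hm))) as [_ [_ [_ [_ L]]]].
      apply Rmult_lt_compat_l; lra. }
    unfold J. generalize (Cmod_ge_0 G). nra. }
  (* Solving conj u H + u G = mu and its conjugate for u shows that w0 - f(m) is a positive multiple
     of the outer normal, against [K]. *)
  assert (EU : (u * J)%C = (mu * Nn)%C).
  { assert (E1 : (Cconj u * H + u * G)%C = mu) by (rewrite <- Emu; unfold H, G; ring).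
    assert (E2 : (u * Cconj H + Cconj u * Cconj G)%C = mu).
    { rewrite <- (Cconj_conj u) at 1. rewrite <- !Cmult_conj, <- Cplus_conj, E1.
      apply injective_projections; simpl; ring. }
    replace (mu * Nn)%C with (mu * H - mu * Cconj G)%C by (unfold Nn; ring).
    rewrite <- E2 at 1. rewrite <- E1.
    unfold J. rewrite RtoC_minus, !Cmod2_conj. ring. }
  assert (EK : mu * Re ((fm - w0) * Cconj Nn) = - (J * Cmod u ^ 2)).
  { rewrite <- re_scal_l.
    replace (mu * ((fm - w0) * Cconj Nn))%C with (- (J * (u * Cconj u)))%C.
    - rewrite <- Cmod2_conj, <- RtoC_mult, <- RtoC_opp. apply re_RtoC.
    - assert (E3 := f_equal Cconj EU). rewrite !Cmult_conj in E3.
      replace (Cconj J) with (RtoC J) in E3 by (apply injective_projections; simpl; ring).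
      replace (Cconj mu) with (RtoC mu) in E3 by (apply injective_projections; simpl; ring).
      replace (fm - w0)%C with (- u)%C by (unfold u; ring).
      replace (mu * (- u * Cconj Nn))%C with (- u * (mu * Cconj Nn))%C by ring.
      rewrite <- E3. ring. }
  assert (0 <= J * Cmod u ^ 2) by (apply Rmult_le_pos; [lra|apply pow2_ge_0]).
  nra.
Qed.

(** * The radius of convexity *)

Lemma is_cseries_geom (q : C) : Cmod q < 1 -> is_cseries (fun n => Cpow q n) (/ (1 - q))%C.
Proof.
intros Hq.
assert (H1 : subexp (fun _ => RtoC 1)).
{ intros r Hr. exists 1. intros n. rewrite Cmod_1, Rmult_1_l.
  rewrite <- (pow1 n). apply pow_incr. lra. }
destruct (subexp_ex_series _ q H1 Hq) as [l Hl].
assert (Hl' : is_cseries (fun n => Cpow q n) l).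
{ apply (is_series_ext (V := C_NormedModule) (fun n => Cpow q n * 1)%C); [intros n; apply Cmult_1_r|exact Hl]. }
assert (Hs : is_cseries (fun n => Cpow q n) (q * l + 1)%C).
{ apply is_cseries_decr_1. replace (q * l + 1 - Cpow q 0)%C with (q * l)%C by (simpl; ring).
  exact (is_series_scal (V := C_NormedModule) q _ _ Hl'). }
assert (E := is_cseries_unique _ _ _ Hl' Hs).
assert (N : (1 - q)%C <> 0) by (apply (one_plus_neq0 (- q)); now rewrite Cmod_opp).
replace (/ (1 - q))%C with l; [exact Hl'|].
assert (E2 : (l * (1 - q))%C = 1).
{ transitivity (l - q * l)%C; [ring|].
  apply (f_equal (fun t => t - q * l)%C) in E. etransitivity; [exact E|]. cbv beta. ring. }
replace l with ((l * (1 - q)) * / (1 - q))%C by (field; exact N).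
rewrite E2. ring.
Qed.

Lemma cz_neq0 (c z : C) : Cmod c < 1 -> unit_disk z -> (1 + c * z)%C <> 0.
Proof. intros Hc Hz. now apply one_plus_neq0, Cmod_mult_lt1. Qed.

Definition homography_coef (c : C) (n : nat) : C :=
  match n with O => 0 | S m => Cpow (- c) m end.

Lemma taylor_homography (h : C -> C) (c : C) :
  Cmod c < 1 -> (forall z, unit_disk z -> h z = (z / (1 + c * z))%C) ->
  taylor h (homography_coef c).
Proof.
intros Hc Hh z Hz. apply is_pseries_Cpow. apply is_cseries_decr_1.
assert (N := cz_neq0 c z Hc Hz).
assert (Hq : Cmod (- c * z) < 1) by (apply Cmod_mult_lt1; [now rewrite Cmod_opp|exact Hz]).
replace (h z - Cpow z 0 * homography_coef c 0)%C with (z * / (1 - (- c * z)))%C.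
- apply (is_series_ext (V := C_NormedModule) (fun n => z * Cpow (- c * z) n)%C).
  + intros n. change (z * Cpow (- c * z) n = Cpow z (S n) * Cpow (- c) n)%C.
    rewrite Cpow_mult_l. simpl. ring.
  + exact (is_series_scal (V := C_NormedModule) z _ _ (is_cseries_geom _ Hq)).
- rewrite Hh by exact Hz. simpl.
  replace (1 - - c * z)%C with (1 + c * z)%C by ring. field. exact N.
Qed.

Lemma cderiv_homography (h : C -> C) (c z : C) :
  Cmod c < 1 -> (forall z, unit_disk z -> h z = (z / (1 + c * z))%C) -> unit_disk z ->
  cderiv h z (/ ((1 + c * z) * (1 + c * z)))%C.
Proof.
intros Hc Hh Hz. assert (N := cz_neq0 c z Hc Hz). destruct (disk_local z Hz) as [P L].
apply (cderiv_local (fun y => y / (1 + c * y))%C _ _ _ _ P).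
{ intros y Hy. symmetry. apply Hh, L, Hy. }
eapply cderiv_eq; [|apply (cderiv_div (fun y => y) (fun y => 1 + c * y)%C);
  [exact N|apply cderiv_id|apply cderiv_affine]].
field. exact N.
Qed.

(** It serves to place the identity in [universal_LIF alpha] for all alpha >= 1. Membership
    prescribes values in the disc only, since the Koebe transforms of such an h are uncontrolled
    outside. *)
Definition homographies (h : C -> C) : Prop :=
  exists c : C, Cmod c < 1 /\ forall z, unit_disk z -> h z = (z / (1 + c * z))%C.

Lemma Cmod_cos_sin (theta : R) : Cmod (cos theta, sin theta) = 1.
Proof.
apply Rsqr_inj; [apply Cmod_ge_0|lra|]. unfold Rsqr.
replace (Cmod (cos theta, sin theta) * Cmod (cos theta, sin theta))
  with (Cmod (cos theta, sin theta) ^ 2) by ring.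
rewrite Cmod2_alt. unfold Re, Im; simpl fst; simpl snd.
generalize (sin2_cos2 theta). unfold Rsqr. lra.
Qed.

Lemma linear_invariant_homographies : linear_invariant_family homographies.
Proof.
split; [|split].
- exists (fun z => z / (1 + 0 * z))%C, 0. split; [rewrite Cmod_0; lra|reflexivity].
- intros h [c [Hc Hh]]. split; [|split].
  + intros z Hz. eexists. apply is_derive_cderiv. now apply (cderiv_homography h c).
  + intros z Hz. rewrite (cderiv_C_derive _ _ _ (cderiv_homography h c z Hc Hh Hz)).
    assert (N := cz_neq0 c z Hc Hz). intros E.
    apply (f_equal (Cmult ((1 + c * z) * (1 + c * z)))) in E.
    rewrite Cinv_r in E by now apply Cmult_neq_0. rewrite Cmult_0_r in E.
    apply RtoC_inj in E. lra.
  + exists (homography_coef c). split; [now apply taylor_homography|now split].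
- intros h phi [c [Hc Hh]] [theta [a [Ha Hphi]]].
  set (e := (cos theta, sin theta) : C).
  assert (He : Cmod e = 1) by apply Cmod_cos_sin.
  assert (Ne : e <> 0) by (apply Cmod_gt_0; lra).
  assert (Hce : Cmod (c * e) < 1) by (rewrite Cmod_mult, He; lra).
  assert (Na : (1 - Cconj a * a)%C <> 0).
  { apply (one_plus_neq0 (- (Cconj a * a))). rewrite Cmod_opp. apply Cmod_mult_lt1; [now rewrite Cmod_conj|exact Ha]. }
  assert (Ncea : (1 + c * e * a)%C <> 0) by now apply cz_neq0.
  assert (Dphi : C_derive phi 0 = (e * (1 - Cconj a * a))%C).
  { apply cderiv_C_derive.
    apply (cderiv_ext (fun z => e * ((z + a) / (1 + Cconj a * z)))%C); [intros y; now rewrite Hphi|].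
    eapply cderiv_eq; [|apply cderiv_scal, mobius_cderiv; [exact Ha|exact unit_disk_0]].
    field. }
  assert (phi0 : phi 0 = (e * a)%C) by (rewrite Hphi; fold e; field; apply C1_nz).
  assert (Hea : unit_disk (e * a)) by (unfold unit_disk; rewrite Cmod_mult, He; lra).
  (* The new parameter is the image of c e under the automorphism with parameter conj a, so it stays
     in the disc. *)
  exists ((c * e + Cconj a) / (1 + Cconj (Cconj a) * (c * e)))%C. split.
  { apply mobius_unit_disk; [now rewrite Cmod_conj|exact Hce]. }
  intros z Hz. unfold koebe_transform. rewrite Dphi, phi0.
  rewrite (cderiv_C_derive _ _ _ (cderiv_homography h c _ Hc Hh Hea)).
  assert (Nz := mobius_denominator a z Ha Hz).
  assert (Hm := mobius_unit_disk a z Ha Hz).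
  assert (Hpz : unit_disk (phi z)).
  { rewrite Hphi. fold e. unfold unit_disk. rewrite Cmod_mult, He, Rmult_1_l. exact Hm. }
  rewrite (Hh _ Hpz), (Hh _ Hea), Hphi. fold e. rewrite Cconj_conj.
  assert (N1 : (1 + Cconj a * z + c * e * (z + a))%C <> 0).
  { replace (1 + Cconj a * z + c * e * (z + a))%C
      with ((1 + Cconj a * z) * (1 + c * phi z))%C by (rewrite Hphi; fold e; field; exact Nz).
    apply Cmult_neq_0; [exact Nz|now apply cz_neq0]. }
  assert (Ncea' : (1 + a * (c * e))%C <> 0) by (replace (1 + a * (c * e))%C with (1 + c * e * a)%C by ring; exact Ncea).
  field. repeat split; try assumption.
  all: intros E; first [apply N1; rewrite <- E; ring|apply Ncea; rewrite <- E; ring].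
Qed.

Lemma family_order_homographies : Rbar_le (family_order homographies) 1.
Proof.
apply Lub_Rbar_correct. intros x [h [a [[c [Hc Hh]] [Ta ->]]]].
(* [a] is an arbitrary expansion of h; it is compared with the explicit one through h''(0). *)
assert (E1 := taylor_coef2 _ _ Ta).
assert (E2 := taylor_coef2 _ _ (taylor_homography h c Hc Hh)).
rewrite E1 in E2. simpl homography_coef in E2.
replace (a 2%nat) with (- c)%C; [rewrite Cmod_opp; simpl; lra|].
replace (a 2%nat) with (/ 2 * (2 * a 2%nat))%C by field.
rewrite E2. field.
Qed.

(** A member of the class bounds the admissible radii, so that the radius of convexity exists as a
    real number. *)
Lemma class_H_id (alpha Q : R) : 1 <= alpha -> 1 <= Q -> class_H alpha Q (fun z => z).
Proof.
intros Ha HQ.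
assert (D1 : forall z, C_derive (fun z => z) z = 1) by (intros z; apply cderiv_C_derive, cderiv_id).
assert (D0 : forall z, C_derive (fun _ => RtoC 0) z = 0) by (intros z; apply cderiv_C_derive, cderiv_const).
exists (fun z => z), (fun _ => RtoC 0), (homography_coef 0), (fun _ => RtoC 0).
repeat split.
- intros z _. eexists. apply is_derive_cderiv, cderiv_id.
- intros z _. eexists. apply is_derive_cderiv, cderiv_const.
- apply taylor_homography; [rewrite Cmod_0; lra|]. intros z _.
  replace (1 + 0 * z)%C with (RtoC 1) by ring. field.
- intros z _. apply is_pseries_Cpow.
  apply (is_series_ext (V := C_NormedModule) (fun _ => RtoC 0)); [intros n; symmetry; apply Cmult_0_r|].
  apply is_cseries_0.
- simpl. apply injective_projections; simpl; ring.
- intros z _. apply injective_projections; simpl; ring.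
- intros z _. rewrite D1, D0, Cmod_1, Cmod_0. lra.
- exists homographies. split; [exact linear_invariant_homographies|]. split.
  + eapply Rbar_le_trans; [exact family_order_homographies|exact Ha].
  + exists 0. split; [rewrite Cmod_0; lra|]. intros z _. rewrite D1.
    replace (1 + 0 * z)%C with (RtoC 1) by ring. reflexivity.
- intros z _. rewrite D1, D0. replace (0 / 1)%C with (RtoC 0) by (field; apply C1_nz).
  rewrite Cmod_0. unfold dilatation_bound. apply Rdiv_le_0_compat; lra.
Qed.

(** * The constants R_0 and R(z), and attainment of the radius *)

Lemma dilatation_shift_nonneg (k : R) : 0 <= k -> 0 <= dilatation_shift k.
Proof.
intros Hk. unfold dilatation_shift. destruct (Req_EM_T k 0) as [|N]; [lra|].
assert (P : 0 < / k) by (apply Rinv_0_lt_compat; lra).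
assert (sqrt ((/ k) ^ 2 - 1) <= / k); [|lra].
rewrite <- (sqrt_pow2 (/ k)) at 2 by lra. apply sqrt_le_1_alt. lra.
Qed.

Lemma R_zero_inv (A : R) : 1 <= A ->
  0 < A - sqrt (A ^ 2 - 1) /\ / (A - sqrt (A ^ 2 - 1)) = A + sqrt (A ^ 2 - 1).
Proof.
intros HA.
assert (Hs : sqrt (A ^ 2 - 1) ^ 2 = A ^ 2 - 1) by (apply pow2_sqrt; nra).
assert (Ps := sqrt_pos (A ^ 2 - 1)).
assert (P : 0 < A - sqrt (A ^ 2 - 1)) by nra.
split; [exact P|]. apply Rmult_eq_reg_l with (A - sqrt (A ^ 2 - 1)); [|lra].
rewrite Rinv_r by lra. nra.
Qed.

(** R_0 and 1/R_0 are A - s and A + s with s^2 = A^2 - 1, so their sum is 2 A and their squared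
    difference 4 (A^2 - 1). *)
Lemma R_at_eq (alpha Q : R) (z : C) :
  1 <= alpha + dilatation_shift (dilatation_bound Q) ->
  R_at alpha Q z = (alpha + dilatation_shift (dilatation_bound Q))
    - sqrt ((alpha + dilatation_shift (dilatation_bound Q)) ^ 2 - 1 + Cmod z ^ 2).
Proof.
unfold R_at, R_zero. set (A := alpha + dilatation_shift (dilatation_bound Q)). cbv zeta.
intros HA. destruct (R_zero_inv A HA) as [P ->].
set (s := sqrt (A ^ 2 - 1)) in *.
assert (Hs : s ^ 2 = A ^ 2 - 1) by (apply pow2_sqrt; nra).
replace ((A - s - (A + s)) ^ 2 + 4 * Cmod z ^ 2) with (2 ^ 2 * (A ^ 2 - 1 + Cmod z ^ 2))
  by (rewrite <- Hs; ring).
rewrite sqrt_mult_alt by lra. rewrite sqrt_pow2 by lra. field.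
Qed.

Lemma R_at_0 (alpha Q : R) :
  1 <= alpha + dilatation_shift (dilatation_bound Q) -> R_at alpha Q 0 = R_zero alpha Q.
Proof.
intros HA. rewrite R_at_eq by exact HA. unfold R_zero. cbv zeta. rewrite Cmod_0.
f_equal. f_equal. ring.
Qed.

(** For the square root T, the identity T^2 - (A - 1 + |z|)^2 = 2 (A - 1) (1 - |z|) gives the first
    claim; the second is (A - rho)^2 > T^2. *)
Lemma admissible_radius (A rho : R) (z : C) :
  1 <= A -> unit_disk z -> rho < A - sqrt (A ^ 2 - 1 + Cmod z ^ 2) ->
  Cmod z + rho < 1 /\ 0 < rho ^ 2 - 2 * A * rho + 1 - Cmod z ^ 2.
Proof.
unfold unit_disk. intros HA Hz Hrho.
assert (P := Cmod_ge_0 z).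
set (T := sqrt (A ^ 2 - 1 + Cmod z ^ 2)) in *.
assert (HT : T ^ 2 = A ^ 2 - 1 + Cmod z ^ 2) by (apply pow2_sqrt; nra).
assert (PT : 0 <= T) by apply sqrt_pos.
split.
- assert (A - 1 + Cmod z <= T); [|lra].
  apply pow2_le_inv; [exact PT|]. rewrite HT. nra.
- nra.
Qed.

(** The supremum of the admissible radii is admissible, since each requirement of [convex_in_disk]
    starts from at most two points, and these lie in a smaller admissible disc. A harmonic map
    convex in a disc need not be convex in smaller concentric ones, so the smaller radius is always
    taken from [E]. *)
Lemma radius_of_convexity_exists (F : (C -> C) -> Prop) (r1 : R) :
  (exists f, F f) -> 0 < r1 -> (forall f, F f -> convex_in_disk f 0 r1) ->
  exists r0, is_radius_of_convexity F r0 /\ r1 <= r0.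
Proof.
intros [f0 Hf0] Hr1 H1.
set (E := fun r => forall f, F f -> convex_in_disk f 0 r).
assert (Hdisk : forall (r : R) z, in_disk 0 r z <-> Cmod z < r).
{ intros r z. unfold in_disk. now replace (z - 0)%C with z by ring. }
assert (Hb : bound E).
{ exists 1. intros r Hr. apply Rnot_lt_le; intros L.
  (* A radius above 1 would put the point 1 in the open unit disc. *)
  destruct (Hr f0 Hf0) as [Hin _].
  assert (U := Hin 1). rewrite Hdisk in U. unfold unit_disk in U. rewrite Cmod_1 in U. lra. }
destruct (completeness E Hb (ex_intro _ r1 H1)) as [r0 [Hub Hlub]].
assert (Hle : r1 <= r0) by (apply Hub; exact H1).
assert (Happ : forall x, x < r0 -> exists r, E r /\ x < r <= r0).
{ intros x Hx. apply NNPP; intros N.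
  assert (r0 <= x); [|lra]. apply Hlub. intros r Hr. apply Rnot_lt_le; intros L.
  apply N. exists r. split; [exact Hr|]. split; [exact L|now apply Hub]. }
exists r0. split; [split|exact Hle].
2: { intros r Hr. now apply Hub. }
intros f Hf. split; [|split; [|split; [|split]]].
- intros z Hz. apply (proj1 (Hdisk _ _)) in Hz. destruct (Happ _ Hz) as [r [Hr [L _]]].
  apply (proj1 (Hr f Hf)). now apply (proj2 (Hdisk _ _)).
- intros z1 z2 Hz1 Hz2. apply (proj1 (Hdisk _ _)) in Hz1. apply (proj1 (Hdisk _ _)) in Hz2.
  destruct (Happ (Rmax (Cmod z1) (Cmod z2))) as [r [Hr [L _]]]; [now apply Rmax_lub_lt|].
  apply (proj1 (proj2 (Hr f Hf))); apply (proj2 (Hdisk _ _)); eapply Rle_lt_trans; [apply Rmax_l|exact L|apply Rmax_r|exact L].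
- exists (f 0), 0. split; [|reflexivity]. apply (proj2 (Hdisk _ _)). rewrite Cmod_0. lra.
- intros w [z [Hz Ew]]. apply (proj1 (Hdisk _ _)) in Hz. destruct (Happ _ Hz) as [r [Hr [L L']]].
  destruct (Hr f Hf) as [_ [_ [_ [Hopen _]]]].
  destruct (Hopen w) as [d Hd]; [exists z; split; [now apply (proj2 (Hdisk _ _))|exact Ew]|].
  exists d. intros y Hy. destruct (Hd y Hy) as [x [Hx Ex]].
  exists x. split; [|exact Ex]. apply (proj1 (Hdisk _ _)) in Hx. apply (proj2 (Hdisk _ _)). lra.
- intros w1 w2 t [z1 [Hz1 E1]] [z2 [Hz2 E2]] Ht. apply (proj1 (Hdisk _ _)) in Hz1. apply (proj1 (Hdisk _ _)) in Hz2.
  destruct (Happ (Rmax (Cmod z1) (Cmod z2))) as [r [Hr [L L']]]; [now apply Rmax_lub_lt|].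
  destruct (Hr f Hf) as [_ [_ [_ [_ Hconv]]]].
  destruct (Hconv w1 w2 t) as [x [Hx Ex]]; [| |exact Ht|].
  + exists z1. split; [|exact E1]. apply (proj2 (Hdisk _ _)). eapply Rle_lt_trans; [apply Rmax_l|exact L].
  + exists z2. split; [|exact E2]. apply (proj2 (Hdisk _ _)). eapply Rle_lt_trans; [apply Rmax_r|exact L].
  + exists x. split; [|exact Ex]. apply (proj1 (Hdisk _ _)) in Hx. apply (proj2 (Hdisk _ _)). lra.
Qed.

Theorem theorem4 :
  forall alpha Q : R, 1 <= alpha -> 1 <= Q ->
    (forall f : C -> C, class_H alpha Q f ->
       forall z : C, unit_disk z -> convex_in_disk f z (R_at alpha Q z)) /\
    (exists r0 : R,
       is_radius_of_convexity (class_H alpha Q) r0 /\ R_zero alpha Q <= r0).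
Proof.
intros alpha Q Ha HQ.
assert (HA : 1 <= alpha + dilatation_shift (dilatation_bound Q)).
{ assert (0 <= dilatation_shift (dilatation_bound Q)); [|lra].
  apply dilatation_shift_nonneg. unfold dilatation_bound. apply Rdiv_le_0_compat; lra. }
assert (Main : forall f : C -> C, class_H alpha Q f ->
  forall z : C, unit_disk z -> convex_in_disk f z (R_at alpha Q z)).
{ intros f Hf z Hz.
  destruct (class_H_stable alpha Q f HQ Hf) as [h [g [h1 [g1 [h2 [g2 [Ef [Hd Hst]]]]]]]].
  rewrite R_at_eq by exact HA.
  set (A := alpha + dilatation_shift (dilatation_bound Q)) in *.
  apply (stable_convex_in_disk A _ z f h g h1 g1 h2 g2).
  - now split.
  - exact Ef.
  - assert (sqrt (A ^ 2 - 1 + Cmod z ^ 2) < A); [|lra].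
    rewrite <- (sqrt_pow2 A) at 2 by lra. apply sqrt_lt_1_alt.
    generalize (Cmod_ge_0 z). unfold unit_disk in Hz. split; nra.
  - intros rho [_ Hrho]. now apply admissible_radius. }
split; [exact Main|].
apply radius_of_convexity_exists.
- exists (fun z => z). now apply class_H_id.
- apply R_zero_inv, HA.
- intros f Hf. rewrite <- R_at_0 by exact HA. now apply Main, unit_disk_0.
Qed.
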